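(* Let $L$ be a full-dimensional rational lattice-free polytope in $\mathbb{R}^m$ having the 2-hyperplane property, and let $M_0<M$ be finite numbers. For any polyhedron $Q\subseteq R(L,M,M_0)$ in $\mathbb{R}^m\times\mathbb{R}$, there exists a finite number $q$ such that the height of the rank-$q$ split closure of $Q$ is at most $M_0$.
   Context: Lattice-free: no integer point in the interior. A split is $(\pi,\pi_0)$, $\pi\in\mathbb{Z}^m$, $\pi_0\in\mathbb{Z}$, acting on the $x$-coordinates of $(x,z)\in\mathbb{R}^m\times\mathbb{R}$, with boundary hyperplanes $\{\pi x=\pi_0\}$, $\{\pi x=\pi_0+1\}$. For a polyhedron $K$, $K(\pi,\pi_0)=\mathrm{conv}((K\cap\{\pi x\le\pi_0\})\cup(K\cap\{\pi x\ge\pi_0+1\}))$; the split closure of $K$ is the intersection of all $K(\pi,\pi_0)$; rank-0 split closure is $K$ and rank-$t$ split closure is the split closure of the rank-$(t-1)$ one. Height of $\bar x\in\mathbb{R}^m$ with respect to $K$: $\max\{\bar z:(\bar x,\bar z)\in K\}$ ($+\infty$ if unbounded, $-\infty$ if empty); height of $K$: supremum over $\bar x$. $R(L,M,M_0)$ is the set of $(\bar x,\bar z)$ with $\bar z\le M$ if $\bar x\in\mathrm{int}(L)$ and $\bar z\le M_0-\frac{d(\bar x,L)}{\mathrm{diam}(L)}(M-M_0)$ otherwise ($d$ Euclidean distance, $\mathrm{diam}$ the diameter of $L$). A set of points is 2-partitionable if it has at most one element or can be partitioned into two nonempty sets lying respectively on the two boundary hyperplanes of some split. $L_I$ is the convex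 hull of integer points in $L$; $L$ has the 2-hyperplane property if every face of $L_I$ not contained in a facet of $L$ has a 2-partitionable set of integer points. *)

(* Defs.v *)
From HB Require Import structures.
From mathcomp Require Import all_boot all_order all_algebra.
From mathcomp Require Import all_classical all_reals.
From mathcomp Require Import ereal.

Set Implicit Arguments.
Unset Strict Implicit.
Unset Printing Implicit Defensive.

Import Order.TTheory GRing.Theory Num.Theory.
Local Open Scope classical_set_scope.
Local Open Scope ring_scope.

Section Defs.
Variable R : realType.

Definition vec (m : nat) := 'rV[R]_m.

Definition dot (m : nat) (a x : vec m) : R := \sum_(i < m) a 0 i * x 0 i.

Definition dotZ (m : nat) (pi : 'rV[int]_m) (x : vec m) : R :=
  \sum_(i < m) (pi 0 i)%:~R * x 0 i.

Definition enorm (m : nat) (v : vec m) : R := Num.sqrt (\sum_(i < m) v 0 i ^+ 2).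

Definition is_int_vec (m : nat) (x : vec m) : Prop :=
  exists z : 'rV[int]_m, x = map_mx (fun k : int => k%:~R) z.

Definition is_rat_vec (m : nat) (x : vec m) : Prop :=
  exists q : 'rV[rat]_m, x = map_mx (@ratr R) q.

Definition conv (m : nat) (S : set (vec m)) : set (vec m) :=
  fun x => exists (k : nat) (p : 'I_k -> vec m) (lam : 'I_k -> R),
    (forall i, 0 <= lam i) /\ \sum_(i < k) lam i = 1 /\
    (forall i, S (p i)) /\ x = \sum_(i < k) lam i *: p i.

Definition conv2 (m : nat) (S : set (vec m * R)) : set (vec m * R) :=
  fun xz => exists (k : nat) (p : 'I_k -> vec m * R) (lam : 'I_k -> R),
    (forall i, 0 <= lam i) /\ \sum_(i < k) lam i = 1 /\
    (forall i, S (p i)) /\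
    xz.1 = \sum_(i < k) lam i *: (p i).1 /\
    xz.2 = \sum_(i < k) lam i * (p i).2.

Definition interior_pts (m : nat) (L : set (vec m)) : set (vec m) :=
  fun x => exists e : R, 0 < e /\ forall y, enorm (y - x) < e -> L y.

Definition rational_polytope (m : nat) (L : set (vec m)) : Prop :=
  exists (k : nat) (p : 'I_k -> vec m),
    (forall i, is_rat_vec (p i)) /\ L = conv [set p i | i in [set: 'I_k]].

Definition full_dimensional (m : nat) (L : set (vec m)) : Prop :=
  exists x, interior_pts L x.

Definition lattice_free (m : nat) (L : set (vec m)) : Prop :=
  forall x, interior_pts L x -> ~ is_int_vec x.

Definition integer_hull (m : nat) (L : set (vec m)) : set (vec m) :=
  conv (fun x => L x /\ is_int_vec x).

Definition face (m : nat) (C F : set (vec m)) : Prop :=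
  exists (a : vec m) (b : R), (forall x, C x -> dot a x <= b) /\
    F = (fun x => C x /\ dot a x = b).

Definition aff_indep (m k : nat) (p : 'I_k -> vec m) : Prop :=
  forall lam : 'I_k -> R, \sum_(i < k) lam i = 0 ->
    \sum_(i < k) lam i *: p i = 0 -> forall i, lam i = 0.

(* facet of a full-dimensional polytope L in R^m: a face of dimension m-1,
   i.e. a proper face containing m affinely independent points *)
Definition facet (m : nat) (L F : set (vec m)) : Prop :=
  face L F /\ F <> L /\
  exists p : 'I_m -> vec m, aff_indep p /\ forall i, F (p i).

Definition two_partitionable (m : nat) (S : set (vec m)) : Prop :=
  (forall x y, S x -> S y -> x = y) \/
  exists (pi : 'rV[int]_m) (pi0 : int) (S1 S2 : set (vec m)),
    S1 !=set0 /\ S2 !=set0 /\ S1 `&` S2 = set0 /\ S = S1 `|` S2 /\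
    (forall x, S1 x -> dotZ pi x = pi0%:~R) /\
    (forall x, S2 x -> dotZ pi x = (pi0 + 1)%:~R).

Definition two_hyperplane_property (m : nat) (L : set (vec m)) : Prop :=
  forall F, face (integer_hull L) F ->
    ~ (exists G, facet L G /\ F `<=` G) ->
    two_partitionable (fun x => F x /\ is_int_vec x).

Definition polyhedron2 (m : nat) (Q : set (vec m * R)) : Prop :=
  exists (k : nat) (A : 'I_k -> vec m) (c b : 'I_k -> R),
    Q = (fun xz => forall j, dot (A j) xz.1 + c j * xz.2 <= b j).

Definition split_hull (m : nat) (K : set (vec m * R)) (pi : 'rV[int]_m) (pi0 : int)
  : set (vec m * R) :=
  conv2 ((fun xz => K xz /\ dotZ pi xz.1 <= pi0%:~R) `|`
         (fun xz => K xz /\ (pi0 + 1)%:~R <= dotZ pi xz.1)).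

Definition split_closure (m : nat) (K : set (vec m * R)) : set (vec m * R) :=
  fun xz => forall (pi : 'rV[int]_m) (pi0 : int), split_hull K pi pi0 xz.

Definition rank_split_closure (m : nat) (t : nat) (K : set (vec m * R)) :=
  iter t (@split_closure m) K.

(* height of xbar w.r.t. K: sup of {z : (xbar,z) in K} in extended reals
   (-oo if empty, +oo if unbounded; equals the max when attained) *)
Definition height_at (m : nat) (K : set (vec m * R)) (xbar : vec m) : \bar R :=
  ereal_sup [set (z%:E)%E | z in [set z | K (xbar, z)]].

Definition height (m : nat) (K : set (vec m * R)) : \bar R :=
  ereal_sup [set height_at K xbar | xbar in [set: vec m]].

Definition dist_set (m : nat) (x : vec m) (L : set (vec m)) : R :=
  inf [set enorm (x - y) | y in L].

Definition diam (m : nat) (L : set (vec m)) : R :=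
  sup [set r | exists x y, L x /\ L y /\ r = enorm (x - y)].

Definition Rset (m : nat) (L : set (vec m)) (M M0 : R) : set (vec m * R) :=
  fun xz => if `[< interior_pts L xz.1 >] then xz.2 <= M
            else xz.2 <= M0 - dist_set xz.1 L / diam L * (M - M0).

End Defs.

(* Main.v *)
Require Import Defs.
From HB Require Import structures.
From mathcomp Require Import all_boot all_order all_algebra.
From mathcomp Require Import all_classical all_reals.
From mathcomp Require Import ereal.
From mathcomp Require Import ring lra zify.
Import Order.TTheory GRing.Theory Num.Theory.
Local Open Scope classical_set_scope.
Local Open Scope ring_scope.

Set Implicit Arguments.
Unset Strict Implicit.
Unset Printing Implicit Defensive.

(** Write K_q for the rank-q split closure of Q. More generally, for every affine
    function l with rational and sufficiently small coefficients which is
    nonnegative on the integer points of L, some K_q satisfies z <= M0 + l(x);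
    the theorem is the case l = 0. The proof is by induction on the number of
    integer points of L at which l vanishes.

    - Limit argument. Take a lexicographic maximum, starting with z - l(x), over
      the limit of the K_q. It is an extreme point, so coordinate splits force
      its x-part to be integral, and hence z <= M0 + l(x) holds in the limit,
      with equality only at convex combinations of integer zeros of l in L.
      Therefore the inequality holds at a finite rank on each half-space that
      contains no such zero.
    - If the zeros of l lie on a proper face a x <= b of L, which may be taken
      integral by Farkas' lemma over the rationals, then z <= M0 already holds
      where a x >= b. The limit argument and the split (a, b - 1) give
      z <= M0 + (b - a x)/N; a second split, parallel to l - (b - a x)/N, gives
      z <= M0 + l.
    - Otherwise the 2-hyperplane property provides a split (p, p0) partitioning
      the zeros. The functions l + (p x - p0)/N and l + (p0 + 1 - p x)/N have
      fewer zeros, and their inequalities imply z <= M0 + l on the two sides of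
      the split. A single zero is a boundary point of L and so lies on a proper
      face. *)

(** * Farkas' lemma over an ordered field *)

(** Induction on [n]. If the first functional cannot be dropped, some [x0] has [b x0 > 0] and makes
    the others nonpositive, so [a ord0 x0 > 0], and projecting along [x0] eliminates [a ord0]. The
    field is arbitrary because the result is applied over the rationals and over the reals. *)
Lemma farkas (F : realFieldType) (X : lmodType F) (n : nat)
    (a : 'I_n -> X -> F) (b : X -> F) :
  (forall i, scalar (a i)) -> scalar b ->
  (forall x, (forall i, a i x <= 0) -> b x <= 0) ->
  exists lam : 'I_n -> F, (forall i, 0 <= lam i) /\
    forall x, b x = \sum_(i < n) lam i * a i x.
Proof.
elim: n a b => [|n IH] a b sa sb hab.
  exists (fun=> 0); split=> [//|x]; rewrite big_ord0.
  have b0 : b 0 = 0.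
    by have := sb (-1) 0 0; rewrite scaler0 addr0 mulN1r addNr.
  apply/eqP; rewrite eq_le (hab x) ?andbT; last by case.
  have /(hab _) : forall i : 'I_0, a i (- x) <= 0 by case.
  have := sb (-1) x 0; rewrite addr0 b0 scaleN1r => ->.
  by rewrite addr0 mulN1r oppr_le0.
have [h|] := pselect (forall x, (forall i : 'I_n, a (lift ord0 i) x <= 0) -> b x <= 0).
  have [lam [lam0 e]] := IH _ _ (fun i => sa _) sb h.
  exists (fun i => oapp lam 0 (unlift ord0 i)); split=> [i|x].
    by case: (unlift ord0 i) => /=.
  rewrite big_ord_recl unlift_none /= mul0r add0r e.
  by apply: eq_bigr => i _; rewrite liftK.
move=> /existsNP[x0 /not_implyP[ha /negP]]; rewrite -ltNge => bx0.
pose c := a ord0 x0.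
have c0 : 0 < c.
  rewrite ltNge; apply/negP => c0.
  suff : b x0 <= 0 by rewrite leNgt bx0.
  by apply: hab => i; case: (unliftP ord0 i) => [j ->|->].
have cn0 : c != 0 by rewrite gt_eqF.
(* [a'] and [b'] are [a] and [b] composed with the projection onto the kernel of [a ord0] along
   [x0]. *)
pose a' (i : 'I_n) x := a (lift ord0 i) x - a (lift ord0 i) x0 / c * a ord0 x.
pose b' x := b x - b x0 / c * a ord0 x.
have sa' i : scalar (a' i).
  by move=> s x y; rewrite /a' !sa; ring.
have sb' : scalar b' by move=> s x y; rewrite /b' sb sa; ring.
have [|lam [lam0 e]] := IH a' b' sa' sb'.
  move=> x hx.
  pose x' := (- (a ord0 x / c)) *: x0 + x.
  have -> : b' x = b x' by rewrite /b' /x' sb; field.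
  apply: hab => i; case: (unliftP ord0 i) => [j ->|->].
    have := hx j; rewrite /a' /x' sa.
    by congr (_ <= _); field.
  by rewrite /x' sa -/c mulNr divfK // addNr.
(* The first weight is forced by evaluation at [x0]; it is nonnegative since [b x0 > 0] and the
   other functionals are nonpositive there. *)
exists (fun i => oapp lam ((b x0 - \sum_(j < n) lam j * a (lift ord0 j) x0) / c)
  (unlift ord0 i)).
split=> [i|x].
  case: (unlift ord0 i) => //=; rewrite divr_ge0 ?(ltW c0) //.
  rewrite subr_ge0 (le_trans _ (ltW bx0)) // sumr_le0 // => j _.
  by rewrite mulr_ge0_le0.
rewrite big_ord_recl unlift_none /=.
under [X in _ = _ + X]eq_bigr do rewrite liftK /=.
have e' : \sum_(i < n) lam i * a' i x = \sum_(i < n) lam i * a (lift ord0 i) x -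
    (\sum_(i < n) lam i * a (lift ord0 i) x0) / c * a ord0 x.
  by rewrite !mulr_suml -sumrB; apply: eq_bigr => i _; rewrite /a'; ring.
by have := e x; rewrite e' /b' mulrBl mulrBl => h; lra.
Qed.

(** * Convex sets and convex hulls in a module *)

Definition convex_set (R : realType) (U : lmodType R) (A : set U) :=
  forall (u v : U) (t : R), 0 <= t <= 1 -> A u -> A v -> A ((1 - t) *: u + t *: v).

(** Common form of [conv] and [conv2], so that one theory serves R^m and R^m x R. *)
Definition hull (R : realType) (U : lmodType R) (S : set U) : set U :=
  fun x => exists (k : nat) (p : 'I_k -> U) (lam : 'I_k -> R),
    [/\ forall i, 0 <= lam i, \sum_(i < k) lam i = 1, forall i, S (p i)
      & x = \sum_(i < k) lam i *: p i].

Section Convex.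
Variables (R : realType) (U : lmodType R).
Implicit Types (A B S : set U).

(** Points of weight zero may lie anywhere: [hull_setU] keeps the points of the other set in the sum
    with weight zero. *)
Lemma convex_set_sum A k (p : 'I_k -> U) (lam : 'I_k -> R) :
  convex_set A -> (forall i, 0 <= lam i) -> \sum_(i < k) lam i = 1 ->
  (forall i, lam i != 0 -> A (p i)) -> A (\sum_(i < k) lam i *: p i).
Proof.
move=> cA; elim: k p lam => [|k IH] p lam lam0 lam1 Ap.
  by move: lam1; rewrite big_ord0 => /esym/eqP; rewrite oner_eq0.
move: lam1; rewrite !big_ord_recl => lam1.
set r := \sum_(i < k) lam (lift ord0 i) in lam1 *.
have r0 : 0 <= r by apply: sumr_ge0.
have [e|rn0] := eqVneq r 0.
  have z i : lam (lift ord0 i) = 0.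
    apply/eqP; move: e => /eqP; rewrite psumr_eq0 // => /allP/(_ i).
    by rewrite mem_index_enum => /(_ isT).
  rewrite big1 ?addr0; last by move=> i _; rewrite z scale0r.
  have l1 : lam ord0 = 1 by rewrite -lam1 e addr0.
  by rewrite l1 scale1r; apply: Ap; rewrite l1 oner_eq0.
pose w := \sum_(i < k) (lam (lift ord0 i) / r) *: p (lift ord0 i).
have Aw : A w.
  apply: IH => [j||j].
  - by rewrite divr_ge0.
  - by rewrite -mulr_suml divff.
  - by rewrite mulf_eq0 negb_or => /andP[h _]; apply: Ap.
have rE : \sum_(i < k) lam (lift ord0 i) *: p (lift ord0 i) =
    r *: w.
  by rewrite scaler_sumr; apply: eq_bigr => i _; rewrite scalerA mulrC divfK.
rewrite rE.
have [e|ln0] := eqVneq (lam ord0) 0.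
  have r1 : r = 1 by rewrite -lam1 e add0r.
  by rewrite e scale0r add0r r1 scale1r.
have -> : lam ord0 = 1 - r by rewrite -lam1 addrK.
by apply: cA => //; [have := lam0 ord0; lra|exact: Ap].
Qed.

Lemma convex_set_hull A S : convex_set A -> S `<=` A -> hull S `<=` A.
Proof.
move=> cA SA x [k [p [lam [lam0 lam1 Sp ->]]]].
by apply: convex_set_sum => // i _; apply: SA.
Qed.

Lemma hull_convex S : convex_set (hull S).
Proof.
move=> u v t /andP[t0 t1] [k [p [a [a0 a1 Sp ->]]]] [l [q [b [b0 b1 Sq ->]]]].
exists (k + l)%N, (fun i => match fintype.split i with inl j => p j | inr j => q j end),
  (fun i => match fintype.split i with inl j => (1 - t) * a j | inr j => t * b j end).
have sl (j : 'I_k) : fintype.split (lshift l j) = inl j by apply: (unsplitK (inl j)).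
have sr (j : 'I_l) : fintype.split (rshift k j) = inr j by apply: (unsplitK (inr j)).
split.
- by move=> i; case: fintype.split => j; rewrite mulr_ge0 // subr_ge0.
- rewrite big_split_ord /=.
  under eq_bigr do rewrite sl.
  under [X in _ + X]eq_bigr do rewrite sr.
  by rewrite -!mulr_sumr a1 b1 !mulr1 subrK.
- by move=> i; case: fintype.split.
- rewrite big_split_ord /= !scaler_sumr; congr (_ + _).
  + by apply: eq_bigr => j _; rewrite sl scalerA.
  + by apply: eq_bigr => j _; rewrite sr scalerA.
Qed.

(** The points of a combination are grouped by membership in [A] and each group is normalised; a
    group of total weight zero gives one of the first two cases. *)
Lemma hull_setU A B x : convex_set A -> convex_set B -> hull (A `|` B) x ->
  [\/ A x, B x | exists a b t, [/\ A a, B b, 0 <= t <= 1 & x = (1 - t) *: a + t *: b]].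
Proof.
move=> cA cB [k [p [lam [lam0 lam1 Sp ->]]]].
pose P i := `[< A (p i) >].
pose s := \sum_(i < k | P i) lam i.
pose t := \sum_(i < k | ~~ P i) lam i.
have s0 : 0 <= s by apply: sumr_ge0.
have t0 : 0 <= t by apply: sumr_ge0.
have st : s + t = 1 by rewrite -lam1 (bigID P) .
have Bp i : ~~ P i -> B (p i) by move=> /asboolPn nA; case: (Sp i).
have [t00|tn0] := eqVneq t 0.
  apply: Or31; apply: convex_set_sum => // i ln0.
  apply/asboolP; rewrite -/(P i); apply: contraT => nP.
  move/eqP: t00; rewrite psumr_eq0 // => /allP/(_ i); rewrite mem_index_enum => /(_ isT).
  by rewrite nP (negPf ln0).
have [s00|sn0] := eqVneq s 0.
  apply: Or32; apply: convex_set_sum => // i ln0.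
  apply: Bp; apply/negP => iP.
  move/eqP: s00; rewrite psumr_eq0 // => /allP/(_ i); rewrite mem_index_enum => /(_ isT).
  by rewrite iP (negPf ln0).
apply: Or33.
exists (\sum_(i < k) (if P i then lam i / s else 0) *: p i),
  (\sum_(i < k) (if ~~ P i then lam i / t else 0) *: p i), t; split.
- apply: convex_set_sum => //.
  + by move=> i; case: ifP => // _; rewrite divr_ge0.
  + by rewrite -big_mkcond /= -mulr_suml divff.
  + by move=> i; case: ifP => [/asboolP//|]; rewrite eqxx.
- apply: convex_set_sum => //.
  + by move=> i; case: ifP => // _; rewrite divr_ge0.
  + by rewrite -big_mkcond /= -mulr_suml divff.
  + by move=> i; case: ifP => [/Bp//|]; rewrite eqxx.
- by lra.
- have -> : 1 - t = s by rewrite -st addrK.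
  rewrite !scaler_sumr -big_split /=; apply: eq_bigr => i _.
  case: (P i); rewrite !scalerA /= ?mulr0 ?scale0r ?addr0 ?add0r mulrC divfK //.
Qed.

End Convex.

(** * Lexicographic limits along a decreasing sequence of sets *)

Definition near_values (R : realType) (V : Type) (f : nat -> V -> R)
    (s : nat -> R) (r : nat) (eta : R) (p : V) :=
  forall k, (k < r)%N -> `|f k p - s k| <= eta.

Section Lex.
Variables (R : realType) (V : Type) (f : nat -> V -> R) (K : nat -> set V).
Hypothesis K_decr : forall n n', (n <= n')%N -> K n' `<=` K n.

Lemma near_values_le s r eta eta' p :
  eta <= eta' -> near_values f s r eta p -> near_values f s r eta' p.
Proof. by move=> le h k kr; apply: le_trans (h k kr) le. Qed.

(* [s] collects the successive values of the lexicographic limit superior of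
   the functionals [f 0, f 1, ...] along the decreasing sequence [K]. *)
Lemma lex_limit (r : nat) :
  (forall k, exists B : R, forall p, K 0%N p -> `|f k p| <= B) ->
  (forall n, K n !=set0) ->
  exists s : nat -> R,
    (forall n (eta : R), 0 < eta -> exists2 p, K n p & near_values f s r eta p) /\
    (forall k, (k < r)%N -> forall eps : R, 0 < eps ->
      exists n (eta : R), 0 < eta /\
        forall p, K n p -> near_values f s k eta p -> f k p <= s k + eps).
Proof.
move=> bnd ne; elim: r => [|r [s [near_s ub_s]]].
  by exists (fun=> 0); split=> // n eta _; have [p Kp] := ne n; exists p.
have [B hB] := bnd r.
(* [sup Y] is the limit superior of [f r] over points of [K n] whose earlier values approach [s]. *)
pose Y : set R := [set y | forall n (eta : R), 0 < eta ->
  exists2 p, K n p & near_values f s r eta p /\ y <= f r p].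
have Y0 : Y !=set0.
  exists (- B) => n eta /(near_s n)[p Kp np]; exists p => //; split=> //.
  by have := hB p (K_decr (leq0n n) Kp); rewrite ler_norml => /andP[].
have Yub : ubound Y B.
  move=> y /(_ 0%N 1 ltr01)[p Kp [_ yf]]; apply: le_trans yf _.
  by have := hB p Kp; rewrite ler_norml => /andP[].
have supY : has_sup Y by split=> //; exists B.
pose t := sup Y.
have ub_t eps : 0 < eps -> exists n (eta : R), 0 < eta /\
    forall p, K n p -> near_values f s r eta p -> f r p <= t + eps.
  move=> eps0; have : ~ Y (t + eps).
    by move=> /(ub_le_sup (ex_intro _ _ Yub)); rewrite -/t; lra.
  move=> /existsNP[n /existsNP[eta /not_implyP[eta0 h]]].
  exists n, eta; split=> // p Kp np; rewrite leNgt; apply/negP => lt.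
  by apply: h; exists p => //; split=> //; apply: ltW.
pose s' k := if k == r then t else s k.
have s's k : (k <= r)%N -> near_values f s' k = near_values f s k.
  move=> kr; apply/funext => eta; apply/funext => p; apply/propext; split=> h j jk.
    by have := h j jk; rewrite /s' ltn_eqF // (leq_trans jk).
  by have := h j jk; rewrite /s' ltn_eqF // (leq_trans jk).
exists s'; split=> [n eta eta0|k].
  have [n1 [eta1 [eta10 h1]]] := ub_t _ eta0.
  have [y Yy ty] := sup_adherent eta0 supY.
  have e0 : 0 < Num.min eta eta1 by rewrite lt_min eta0.
  have [p Kp [np yf]] := Yy (maxn n n1) _ e0.
  exists p; first exact: K_decr (leq_maxl _ _) _ Kp.
  move=> k; rewrite ltnS leq_eqVlt => /predU1P[->|kr].
    rewrite /s' eqxx ler_norml.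
    have : f r p <= t + eta.
      apply: h1; first exact: K_decr (leq_maxr _ _) _ Kp.
      by apply: near_values_le np; rewrite ge_min lexx orbT.
    by move: ty; rewrite -/t; lra.
  rewrite /s' (ltn_eqF kr).
  by apply: le_trans (np k kr) _; rewrite ge_min lexx.
rewrite ltnS leq_eqVlt => /predU1P[->|kr] eps eps0.
  by rewrite s's // /s' eqxx; apply: ub_t.
by rewrite s's ?(ltnW kr) // /s' (ltn_eqF kr); apply: ub_s.
Qed.

(* By induction on the functionals: both [f k u] and [f k v] are almost bounded by
   [s k], while their average, with weights at least [tau], is almost [s k]. *)
Lemma lex_limit_extreme (r : nat) (s : nat -> R) (tau : R) :
  0 < tau ->
  (forall k, (k < r)%N -> forall eps : R, 0 < eps ->
      exists n (eta : R), 0 < eta /\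
        forall p, K n p -> near_values f s k eta p -> f k p <= s k + eps) ->
  forall eps : R, 0 < eps -> exists n (eta : R), 0 < eta /\
    forall e u v t, near_values f s r eta e -> K n u -> K n v ->
      tau <= t <= 1 - tau ->
      (forall k, f k e = (1 - t) * f k u + t * f k v) ->
      near_values f s r eps u /\ near_values f s r eps v.
Proof.
move=> tau0; elim: r => [|r IH] ub_s eps eps0.
  by exists 0%N, 1; split=> // e u v t _ _ _ _ _; split=> k; rewrite ltn0.
(* If one endpoint were below [s r - eps], its weight of at least [tau] would pull the average below
   [s r - eps1], because [2 eps1 <= tau eps] and the other endpoint is at most [s r + eps1]. *)
pose eps1 := Num.min eps (eps * tau / 2).
have eps10 : 0 < eps1.
  by rewrite lt_min eps0 /= divr_gt0 // mulr_gt0.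
have eps1_le : eps1 <= eps by rewrite ge_min lexx.
have eps1_le2 : eps1 <= eps * tau / 2 by rewrite ge_min lexx orbT.
have [n1 [eta1 [eta10 h1]]] := ub_s r (ltnSn r) _ eps10.
have e20 : 0 < Num.min eps eta1 by rewrite lt_min eps0.
have [|n2 [eta2 [eta20 h2]]] := IH _ _ e20.
  by move=> k kr; apply: ub_s; apply: ltnW.
exists (maxn n1 n2), (Num.min eps1 eta2); split; first by rewrite lt_min eps10.
move=> e u v t ne Ku Kv tt fe.
have ne2 : near_values f s r eta2 e.
  move=> k kr; apply: le_trans (ne k (ltnW kr)) _.
  by rewrite ge_min lexx orbT.
have [nu nv] := h2 e u v t ne2 (K_decr (leq_maxr _ _) Ku) (K_decr (leq_maxr _ _) Kv) tt fe.
have le1 : Num.min eps eta1 <= eta1 by rewrite ge_min lexx orbT.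
have le2 : Num.min eps eta1 <= eps by rewrite ge_min lexx.
have fu := h1 u (K_decr (leq_maxl _ _) Ku) (near_values_le le1 nu).
have fv := h1 v (K_decr (leq_maxl _ _) Kv) (near_values_le le1 nv).
have : - eps1 <= f r e - s r.
  have := ne r (ltnSn r); rewrite ler_norml => /andP[h _].
  by apply: le_trans h; rewrite lerN2 ge_min lexx.
rewrite fe => fr.
suff [hu hv] : - eps <= f r u - s r /\ - eps <= f r v - s r.
  split=> k; rewrite ltnS leq_eqVlt => /predU1P[->|kr].
  - by rewrite ler_norml; lra.
  - exact: near_values_le le2 nu k kr.
  - by rewrite ler_norml; lra.
  - exact: near_values_le le2 nv k kr.
case/andP: tt => tt1 tt2.
split; rewrite leNgt; apply/negP => lt; nra.
Qed.

End Lex.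

(** * Dot products and the l1 norm *)

Section Vectors.
Variables (R : realType) (m : nat).
Implicit Types (a g x y : vec R m).

Definition norm1 x : R := \sum_(i < m) `|x 0 i|.

Definition intv (z : 'rV[int]_m) : vec R m := map_mx (fun k : int => k%:~R) z.

Lemma norm1_ge0 x : 0 <= norm1 x.
Proof. by apply: sumr_ge0. Qed.

Lemma norm1_coord x i : `|x 0 i| <= norm1 x.
Proof. by rewrite /norm1 (bigD1 i) //= lerDl sumr_ge0. Qed.

Lemma dot_scalar a : scalar (dot a).
Proof.
move=> s x y; rewrite /dot mulr_sumr -big_split /=; apply: eq_bigr => i _.
by rewrite !mxE; ring.
Qed.

Lemma dotC a x : dot a x = dot x a.
Proof. by apply: eq_bigr => i _; rewrite mulrC. Qed.

Lemma dotB a x y : dot a (x - y) = dot a x - dot a y.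
Proof. by rewrite addrC -scaleN1r dot_scalar mulN1r addrC. Qed.

Lemma dotD a x y : dot a (x + y) = dot a x + dot a y.
Proof. by rewrite -[x in LHS]scale1r dot_scalar mul1r. Qed.

Lemma dotZr a s x : dot a (s *: x) = s * dot a x.
Proof. by rewrite /dot mulr_sumr; apply: eq_bigr => i _; rewrite mxE; ring. Qed.

Lemma dot_sumr a k (lam : 'I_k -> R) (p : 'I_k -> vec R m) :
  dot a (\sum_(i < k) lam i *: p i) = \sum_(i < k) lam i * dot a (p i).
Proof.
elim/big_ind2: _ => [|x r y s <- <-|i _]; last exact: dotZr.
  by rewrite /dot big1 // => i _; rewrite mxE mulr0.
by rewrite dotD.
Qed.

Lemma dotZE (pi : 'rV[int]_m) x : dotZ pi x = dot (intv pi) x.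
Proof. by apply: eq_bigr => i _; rewrite mxE. Qed.

Lemma dot_le_norm1 a x r : (forall i, `|x 0 i| <= r) -> `|dot a x| <= norm1 a * r.
Proof.
move=> xr; apply: le_trans (ler_norm_sum _ _ _) _.
rewrite /norm1 mulr_suml; apply: ler_sum => i _.
by rewrite normrM ler_wpM2l.
Qed.

Lemma dot_delta x i : dot (delta_mx 0 i) x = x 0 i.
Proof.
rewrite /dot (bigD1 i) //= big1 ?addr0.
  by rewrite mxE !eqxx mul1r.
by move=> j ji; rewrite mxE eqxx /= (negPf ji) mul0r.
Qed.

Lemma intv_delta i : intv (delta_mx 0 i) = delta_mx 0 i.
Proof. by apply/rowP => j; rewrite !mxE; case: andP. Qed.

End Vectors.

(** * Split closures: convexity, monotonicity, valid inequalities *)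

Section SplitClosure.
Variables (R : realType) (m : nat).
Let U : lmodType R := (vec R m * R^o)%type.
Implicit Types (K : set (vec R m * R)).

Lemma convex_halfspace (F : U -> R) c : scalar F -> convex_set (U := U) [set p | F p <= c].
Proof.
move=> sF u v t tt /= hu hv.
have F0 : F 0 = 0 by have := sF (-1) 0 0; rewrite scaler0 addr0 mulN1r addNr.
rewrite sF; have -> : F (t *: v) = t * F v by rewrite -[t *: v]addr0 sF F0 addr0.
nra.
Qed.

Lemma split_hullE K (pi : 'rV[int]_m) pi0 :
  split_hull K pi pi0 = hull (U := U)
    ([set p | K p /\ dotZ pi p.1 <= pi0%:~R] `|` [set p | K p /\ (pi0 + 1)%:~R <= dotZ pi p.1]).
Proof.
apply/funext => -[x z]; apply/propext; split.
  move=> [k [p [lam [lam0 [lam1 [Sp [/= e1 e2]]]]]]].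
  exists k, p, lam; split=> //.
  rewrite [RHS]surjective_pairing; congr pair.
    by rewrite e1; elim/big_ind2: _ => [|? ? ? ? -> ->|].
  by rewrite e2; elim/big_ind2: _ => [|? ? ? ? -> ->|].
move=> [k [p [lam [lam0 lam1 Sp e]]]].
exists k, p, lam; do 3![split=> //].
rewrite e; split.
  by elim/big_ind2: _ => [|? ? ? ? <- <-|].
by elim/big_ind2: _ => [|? ? ? ? <- <-|].
Qed.

Lemma dotZ_fst_scalar (pi : 'rV[int]_m) : scalar (fun p : U => dotZ pi p.1).
Proof. by move=> s x y; rewrite !dotZE dot_scalar. Qed.

Lemma convex_setI_halfspaces K (pi : 'rV[int]_m) (pi0 : R) :
  convex_set (U := U) K ->
  convex_set (U := U) [set p | K p /\ dotZ pi p.1 <= pi0] /\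
  convex_set (U := U) [set p | K p /\ pi0 <= dotZ pi p.1].
Proof.
move=> cK; split=> u v t tt [Ku hu] [Kv hv]; split; try exact: cK.
  exact: (@convex_halfspace (fun p : U => dotZ pi p.1) _ (dotZ_fst_scalar pi) u v t tt hu hv).
rewrite -lerN2.
have sN : scalar (fun p : U => - dotZ pi p.1).
  by move=> s x y; rewrite dotZ_fst_scalar opprD mulrN.
by apply: (@convex_halfspace _ _ sN u v t tt); rewrite /= lerN2.
Qed.

Lemma split_closure_convex K : convex_set (U := U) (split_closure K).
Proof.
move=> u v t tt Ku Kv pi pi0; have := Ku pi pi0; have := Kv pi pi0.
by rewrite split_hullE => hv hu; apply: hull_convex.
Qed.

Lemma split_closure_sub K : convex_set (U := U) K -> split_closure K `<=` K.
Proof.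
move=> cK p /(_ 0 0); rewrite split_hullE; apply: convex_set_hull => //.
by move=> q [[]|[]].
Qed.

Lemma rank_split_closure_convex q K :
  convex_set (U := U) K -> convex_set (U := U) (rank_split_closure q K).
Proof. by case: q => //= q _; apply: split_closure_convex. Qed.

Lemma rank_split_closure_decr K n n' : convex_set (U := U) K -> (n <= n')%N ->
  rank_split_closure n' K `<=` rank_split_closure n K.
Proof.
move=> cK /subnK <-; elim: (n' - n)%N => [//|k IH] p.
rewrite addSn => /split_closure_sub h; apply: IH; apply: h.
exact: rank_split_closure_convex.
Qed.

(** The points below the graph of an affine function form a convex set, which contains the hull of
    the two sides once it contains each side. *)
Lemma split_closure_cut K (g : vec R m) (g0 : R) (pi : 'rV[int]_m) (pi0 : int) :
  (forall p, K p -> dotZ pi p.1 <= pi0%:~R -> p.2 <= g0 + dot g p.1) ->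
  (forall p, K p -> (pi0 + 1)%:~R <= dotZ pi p.1 -> p.2 <= g0 + dot g p.1) ->
  forall p, split_closure K p -> p.2 <= g0 + dot g p.1.
Proof.
move=> h1 h2 p /(_ pi pi0); rewrite split_hullE => hp.
have sF : scalar (fun p : U => p.2 - dot g p.1 : R).
  move=> s x y /=; rewrite dot_scalar.
  by rewrite (_ : s *: x.2 = s * x.2) //; ring.
have := convex_set_hull (convex_halfspace (c := g0) sF) _ hp.
rewrite /= lerBlDr; apply.
by move=> q [[Kq hq]|[Kq hq]] /=; rewrite lerBlDr; [exact: h1|exact: h2].
Qed.

Lemma mix_mix (W : lmodType R) (a b : W) (t s s' : R) :
  (1 - t) *: ((1 - s) *: a + s *: b) + t *: ((1 - s') *: a + s' *: b) =
  (1 - ((1 - t) * s + t * s')) *: a + ((1 - t) * s + t * s') *: b.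
Proof.
rewrite !scalerDr !scalerA addrACA -!scalerDl; congr (_ *: _ + _ *: _).
by ring.
Qed.

(** A segment of [K] through [e] joins the two sides of the split; it is shortened to the points
    where it crosses the two hyperplanes. This makes the weights depend only on [e.1 0 i]. *)
Lemma split_closure_coord K (e : U) i (j : int) : convex_set (U := U) K ->
  split_closure K e -> j%:~R < e.1 0 i < (j + 1)%:~R ->
  exists u v : U, [/\ K u, K v, u.1 0 i = j%:~R, v.1 0 i = (j + 1)%:~R &
    e = (1 - (e.1 0 i - j%:~R)) *: u + (e.1 0 i - j%:~R) *: v].
Proof.
move=> cK /(_ (delta_mx 0 i) j); rewrite split_hullE => he /andP[je ej].
have E p : dotZ (delta_mx 0 i) p = p 0 i by rewrite dotZE intv_delta dot_delta.
have [cA _] := convex_setI_halfspaces (delta_mx 0 i) j%:~R cK.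
have [_ cB] := convex_setI_halfspaces (delta_mx 0 i) (j + 1)%:~R cK.
have [[_]|[_]|] := hull_setU cA cB he; rewrite ?E; [lra|lra|].
move=> [a [b [t [[Ka]]]]]; rewrite E => aj [Kb]; rewrite E => jb tt ee.
have ei : e.1 0 i = (1 - t) * a.1 0 i + t * b.1 0 i by rewrite ee !mxE.
have J : (j + 1)%:~R = j%:~R + 1 :> R by rewrite intrD.
rewrite J in ej jb *.
set w := b.1 0 i - a.1 0 i.
have w1 : 1 <= w by rewrite /w; lra.
have w0 : w != 0 by rewrite gt_eqF //; lra.
have wi : 0 < w^-1 by rewrite invr_gt0; lra.
have sec (c : R) : a.1 0 i <= c <= b.1 0 i ->
    0 <= (c - a.1 0 i) / w <= 1.
  move=> cc; rewrite divr_ge0 ?ler_pdivrMr /w; lra.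
set s := (j%:~R - a.1 0 i) / w.
set s' := (j%:~R + 1 - a.1 0 i) / w.
have hs : 0 <= s <= 1 by apply: sec; lra.
have hs' : 0 <= s' <= 1 by apply: sec; lra.
exists ((1 - s) *: a + s *: b), ((1 - s') *: a + s' *: b); split.
- exact: cK.
- exact: cK.
- by rewrite /= !mxE /s /w; field.
- by rewrite /= !mxE /s' /w; field.
rewrite mix_mix {1}ee.
have -> : (1 - (e.1 0 i - j%:~R)) * s + (e.1 0 i - j%:~R) * s' = t.
  by rewrite ei /s /s' /w; field.
by [].
Qed.

End SplitClosure.

(** * The limit argument *)

Section Limit.
Variables (R : realType) (m : nat).
Let U : lmodType R := (vec R m * R^o)%type.

Definition closed_pts (Q : set (vec R m * R)) := forall (x : vec R m) (z : R),
  (forall eta : R, 0 < eta -> exists p, [/\ Q p, forall i, `|p.1 0 i - x 0 i| <= eta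
                                   & `|p.2 - z| <= eta]) -> Q (x, z).

(** For [c > 0], superlevel sets of z - g x are then bounded in x whenever the coordinates of g stay
    below [c]. *)
Definition coercive (Q : set (vec R m * R)) (C c : R) :=
  forall p, Q p -> p.2 <= C - c * norm1 p.1.

Definition lex_functional (g : vec R m) (g0 : R) (gam : vec R m) (k : nat)
    (p : vec R m * R) : R :=
  match k with
  | 0 => p.2 - (g0 + dot g p.1)
  | 1 => dot gam p.1
  | k.+2 => if insub k is Some i then p.1 0 i else 0
  end.

Lemma lex_functional_coord (g : vec R m) (g0 : R) (gam : vec R m) (i : 'I_m) p :
  lex_functional g g0 gam i.+2 p = p.1 0 i.
Proof. by rewrite /= valK. Qed.

Lemma lex_functional_mix (g : vec R m) (g0 : R) (gam : vec R m) k (u v : U) t :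
  lex_functional g g0 gam k ((1 - t) *: u + t *: v) =
  (1 - t) * lex_functional g g0 gam k u + t * lex_functional g g0 gam k v.
Proof.
case: k => [|[|k]] /=.
- rewrite dotD !dotZr.
  rewrite (_ : (1 - t) *: u.2 = (1 - t) * u.2) // (_ : t *: v.2 = t * v.2) //; ring.
- by rewrite dotD !dotZr.
- by case: insub => [i|]; rewrite ?mxE //; ring.
Qed.

(** Slopes of at most [c / 2] leave the first functional a decay of rate [c / 2] in [norm1], so its
    superlevel sets are bounded in x, and with them the other functionals. *)
Lemma lex_functional_bounded (Q : set (vec R m * R)) (C c : R) (g : vec R m)
    (g0 : R) (gam : vec R m) (A : R) k :
  0 < c -> coercive Q C c ->
  (forall i, `|g 0 i| <= c / 2) ->
  exists B : R, forall p, Q p -> A <= lex_functional g g0 gam 0 p ->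
    `|lex_functional g g0 gam k p| <= B.
Proof.
move=> c0 coer gc.
have key p : Q p -> p.2 - (g0 + dot g p.1) <= C + `|g0| - c / 2 * norm1 p.1.
  move=> /coer h.
  have : `|dot g p.1| <= c / 2 * norm1 p.1.
    apply: le_trans (ler_norm_sum _ _ _) _; rewrite /norm1 mulr_sumr.
    by apply: ler_sum => i _; rewrite normrM ler_wpM2r.
  have := ler_norm (- g0); rewrite normrN.
  rewrite ler_norml => ? /andP[? _]; lra.
pose N := (C + `|g0| - A) / (c / 2).
have hN p : Q p -> A <= lex_functional g g0 gam 0 p -> norm1 p.1 <= N.
  move=> /key h1 /= h2; rewrite /N ler_pdivlMr; last lra.
  by rewrite mulrC; lra.
case: k => [|[|k]].
- exists (`|A| + `|C + `|g0| |) => p Qp h.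
  have := key p Qp; have := h; rewrite /=.
  have := norm1_ge0 p.1; set n := norm1 _ => n0.
  have : 0 <= c / 2 * n by apply: mulr_ge0; lra.
  rewrite ler_norml.
  have := ler_norm (C + `|g0|); have := ler_norm (- A); rewrite normrN.
  have := normr_ge0 (C + `|g0|); have := normr_ge0 A.
  lra.
- exists (norm1 gam * N) => p Qp h /=; apply: dot_le_norm1 => i.
  exact: le_trans (norm1_coord _ _) (hN _ Qp h).
- exists `|N| => p Qp h /=; case: insub => [i|]; last by rewrite normr0.
  apply: le_trans (norm1_coord _ _) _.
  by apply: le_trans (hN _ Qp h) (ler_norm _).
Qed.

(* The lexicographic maximum of [z - (g0 + g x)], [gam x], [x_1], ..., [x_m]
   over the limit of the closures is an extreme point, hence its
   [x]-coordinates are unaffected by splits and must be integral. *)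
Lemma split_limit (Q : set (vec R m * R)) (C c : R) (g : vec R m) (g0 : R)
    (gam : vec R m) (b M0 : R) :
  convex_set (U := U) Q -> closed_pts Q -> 0 < c -> coercive Q C c ->
  (forall i, `|g 0 i| <= c / 2) ->
  (forall p, Q p -> is_int_vec p.1 -> p.2 <= M0 + (g0 + dot g p.1)) ->
  (forall p, Q p -> is_int_vec p.1 -> p.2 = M0 + (g0 + dot g p.1) -> dot gam p.1 < b) ->
  exists q, forall p, rank_split_closure q Q p -> b <= dot gam p.1 ->
    p.2 <= M0 + (g0 + dot g p.1).
Proof.
move=> cQ clQ c0 coer gc hI hIb; apply: contrapT => /forallNP H.
have bad q : exists p, [/\ rank_split_closure q Q p, b <= dot gam p.1
    & M0 < p.2 - (g0 + dot g p.1)].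
  have /existsNP[p /not_implyP[Kp /not_implyP[bp /negP]]] := H q.
  by rewrite -ltNge => h; exists p; split=> //; lra.
pose f := lex_functional g g0 gam.
pose K q := rank_split_closure q Q.
(* Truncation at [M0 - 1] makes the functionals bounded and keeps the violating points, whose first
   value exceeds [M0]. *)
pose K' q := [set p | K q p /\ M0 - 1 <= f 0%N p].
have Kd n n' : (n <= n')%N -> K n' `<=` K n by exact: rank_split_closure_decr.
have K'd n n' : (n <= n')%N -> K' n' `<=` K' n.
  by move=> nn p [Kp hp]; split=> //; apply: Kd Kp.
have K'b k : exists B : R, forall p, K' 0%N p -> `|f k p| <= B.
  have [B hB] := lex_functional_bounded g0 gam (M0 - 1) k c0 coer gc.
  by exists B => p [Qp hp]; apply: hB.
have K'n n : K' n !=set0.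
  by have [p [Kp _ hp]] := bad n; exists p; split=> //=; rewrite /f /=; lra.
have [s [near_s ub_s']] := lex_limit K'd m.+2 K'b K'n.
have s0 : M0 <= s 0%N.
  apply/ler_addgt0Pr => eps eps0.
  have [n [eta [eta0 h]]] := ub_s' 0%N isT eps eps0.
  have [p [Kp _ hp]] := bad n.
  have /h h' : K' n p by split=> //=; rewrite /f /=; lra.
  by apply: le_trans (h' _) => //; apply: ltW.
(* The bounds pass from [K'] to [K], where the endpoints of splits live: a first value within 1 of
   [s 0 >= M0] is at least [M0 - 1], and at index 0 smaller values satisfy the bound anyway. *)
have ub_s k : (k < m.+2)%N -> forall eps : R, 0 < eps ->
    exists n (eta : R), 0 < eta /\
      forall p, K n p -> near_values f s k eta p -> f k p <= s k + eps.
  move=> km eps eps0; have [n [eta [eta0 h]]] := ub_s' k km eps eps0.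
  exists n, (Num.min eta 1); split; first by rewrite lt_min eta0 /=.
  move=> p Kp np.
  have [|lt] := leP (M0 - 1) (f 0%N p).
    move=> le; apply: h; first by split.
    by apply: near_values_le np; rewrite ge_min lexx.
  case: k km h np => [|k] km h np; first lra.
  have := np 0%N isT; rewrite ler_norml => /andP[+ _].
  have : Num.min eta 1 <= 1 by rewrite ge_min lexx orbT.
  lra.
have int_s (i : 'I_m) : s i.+2 = (Num.floor (s i.+2))%:~R.
  set j := Num.floor _.
  apply/eqP; rewrite eq_le andbC floor_le /= leNgt; apply/negP => js.
  have sj : s i.+2 < j%:~R + 1.
    by have := floorD1_gt (s i.+2); rewrite intrD.
  (* Half the distance to the nearer of [j] and [j + 1]: points within [tau] of the limit have both
     weights at least [tau], while the endpoint with coordinate [j] is at least [2 tau] away,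
     against extremality. *)
  pose tau := Num.min (s i.+2 - j%:~R) (j%:~R + 1 - s i.+2) / 2.
  have tau0 : 0 < tau by rewrite divr_gt0 // lt_min; lra.
  have tau1 : 2 * tau <= s i.+2 - j%:~R by rewrite mulrC divfK // ge_min lexx.
  have tau2 : 2 * tau <= j%:~R + 1 - s i.+2 by rewrite mulrC divfK // ge_min lexx orbT.
  have [n [eta [eta0 h]]] := lex_limit_extreme Kd tau0 ub_s tau0.
  have e0 : 0 < Num.min eta tau by rewrite lt_min eta0.
  have [e [Ke _] ne] := near_s n.+1 _ e0.
  have im : (i.+2 < m.+2)%N by rewrite !ltnS.
  have := ne _ im; rewrite /f lex_functional_coord ler_norml => /andP[ne1 ne2].
  have le2 : Num.min eta tau <= tau by rewrite ge_min lexx orbT.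
  have [|u [v [Ku Kv ui vi ee]]] := @split_closure_coord R m (K n) e i j
      (rank_split_closure_convex (q := n) cQ) Ke.
    by rewrite intrD; apply/andP; split; lra.
  have [|||nu _] := h e u v (e.1 0 i - j%:~R) _ Ku Kv.
  - by apply: near_values_le ne; rewrite ge_min lexx.
  - by lra.
  - by move=> k; rewrite {1}ee; apply: lex_functional_mix.
  have := nu _ im; rewrite /f lex_functional_coord ui ler_norml; lra.
pose x : vec R m := \row_(i < m) s i.+2.
have xi : is_int_vec x.
  by exists (\row_i Num.floor (s i.+2)); apply/rowP => i; rewrite !mxE.
have Qx : Q (x, s 0%N + (g0 + dot g x)).
  apply: clQ => eta eta0.
  (* The 1 accounts for the error in the first functional, [norm1 g] for that of the coordinates. *)
  pose D := 1 + norm1 g.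
  have D0 : 1 <= D by rewrite /D lerDl norm1_ge0.
  have eD : 0 < eta / D by rewrite divr_gt0 //; lra.
  have eDl : eta / D <= eta by rewrite ler_pdivrMr; [rewrite ler_peMr //; lra|lra].
  have [p [Kp _] np] := near_s 0%N _ eD.
  have hx i : `|p.1 0 i - x 0 i| <= eta / D.
    have im : (i.+2 < m.+2)%N by rewrite !ltnS.
    by have := np _ im; rewrite /f lex_functional_coord mxE.
  exists p; split=> //; first by move=> i; apply: le_trans (hx i) eDl.
  have h1 : `|dot g (p.1 - x)| <= norm1 g * (eta / D).
    by apply: dot_le_norm1 => i; rewrite !mxE; have := hx i; rewrite mxE.
  have h2 : `|p.2 - (g0 + dot g p.1) - s 0%N| <= eta / D by exact: (np 0%N isT).
  have -> : eta = eta / D + norm1 g * (eta / D) 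
    by rewrite /D; field; rewrite -/D gt_eqF //; lra.
  have -> : p.2 - (s 0%N + (g0 + dot g x)) =
    (p.2 - (g0 + dot g p.1) - s 0%N) + dot g (p.1 - x) by rewrite dotB; ring.
  by apply: le_trans (ler_normD _ _) _; apply: lerD.
have sM0 : s 0%N = M0.
  by apply/eqP; rewrite eq_le s0 andbT; have := hI _ Qx xi; rewrite /=; lra.
have := hIb _ Qx xi; rewrite /= sM0 => /(_ erefl).
rewrite ltNge => /negP; apply.
(* At large rank the first value of a violating point lies between [M0] and [M0 + eta], hence near
   [s 0], so its value of [gam], at least [b], is almost bounded by [s 1]. *)
have s1 : b <= s 1%N.
  apply/ler_addgt0Pr => eps eps0.
  have [n1 [eta [eta0 h]]] := ub_s 1%N isT eps eps0.
  have [n2 [eta2 [eta20 h2]]] := ub_s 0%N isT eta eta0.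
  have [p [Kp bp hp]] := bad (maxn n1 n2).
  apply: le_trans bp _; apply: h; first exact: Kd (leq_maxl _ _) _ Kp.
  case=> // _; rewrite ler_norml sM0.
  have := h2 p (Kd _ _ (leq_maxr _ _) _ Kp); rewrite sM0 => h2'.
  have : f 0%N p <= M0 + eta by apply: h2'.
  rewrite /f /=; lra.
apply: le_trans s1 _; apply/ler_addgt0Pr => eps eps0.
pose D := 1 + norm1 gam.
have D0 : 1 <= D by rewrite /D lerDl norm1_ge0.
have eD : 0 < eps / D by rewrite divr_gt0 //; lra.
have [p [Kp _] np] := near_s 0%N _ eD.
have h1 : `|dot gam (p.1 - x)| <= norm1 gam * (eps / D).
  apply: dot_le_norm1 => i; have im : (i.+2 < m.+2)%N by rewrite !ltnS.
  by have := np _ im; rewrite /f lex_functional_coord !mxE.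
have h2 : `|dot gam p.1 - s 1%N| <= eps / D by exact: (np 1%N isT).
have -> : eps = eps / D + norm1 gam * (eps / D) 
    by rewrite /D; field; rewrite -/D gt_eqF //; lra.
move: h1 h2; rewrite dotB !ler_norml; lra.
Qed.

End Limit.

(** * Polytopes: separation and supporting hyperplanes *)

Section Polytope.
Variables (R : realType) (m : nat).
Implicit Types (a x y v : vec R m).

Lemma convE (S : set (vec R m)) : conv S = hull S.
Proof.
apply/funext => x; apply/propext; split=> -[k [p [lam]]].
  by move=> [? [? [? ?]]]; exists k, p, lam.
by move=> [? ? ? ?]; exists k, p, lam.
Qed.

Lemma polytopeP k (p : 'I_k -> vec R m) x :
  conv [set p i | i in [set: 'I_k]] x <->
  exists lam : 'I_k -> R, [/\ forall i, 0 <= lam i, \sum_(i < k) lam i = 1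
    & x = \sum_(i < k) lam i *: p i].
Proof.
rewrite convE; split.
  pose W : set (vec R m) := [set x | exists lam : 'I_k -> R,
    [/\ forall i, 0 <= lam i, \sum_(i < k) lam i = 1 & x = \sum_(i < k) lam i *: p i]].
  apply: (@convex_set_hull _ _ W) =>
    [u v t /andP[t0 t1] [a [a0 a1 ->]] [b [b0 b1 ->]]|_ [i _ <-]].
    exists (fun i => (1 - t) * a i + t * b i); split=> [i||].
    - by rewrite addr_ge0 // mulr_ge0 // subr_ge0.
    - by rewrite big_split /= -!mulr_sumr a1 b1 !mulr1 subrK.
    - rewrite !scaler_sumr -big_split /=; apply: eq_bigr => i _.
      by rewrite !scalerA -scalerDl.
  exists (fun j => (j == i)%:R); split=> [j||].
  - exact: ler0n.
  - by rewrite (bigD1 i) //= eqxx big1 ?addr0 // => j /negPf ->.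
  - by rewrite (bigD1 i) //= eqxx scale1r big1 ?addr0 // => j /negPf ->; rewrite scale0r.
by move=> [lam [lam0 lam1 ->]]; exists k, p, lam; split.
Qed.

Lemma polytope_vertex k (p : 'I_k -> vec R m) i : conv [set p i | i in [set: 'I_k]] (p i).
Proof.
rewrite convE; exists 1%N, (fun=> p i), (fun=> 1); rewrite !big_ord1 scale1r.
by split=> // _; exists i.
Qed.

Lemma polytope_le k (p : 'I_k -> vec R m) a b x :
  (forall i, dot a (p i) <= b) -> conv [set p i | i in [set: 'I_k]] x -> dot a x <= b.
Proof.
move=> h /polytopeP[lam [lam0 lam1 ->]]; rewrite dot_sumr.
rewrite -[b]mul1r -lam1 mulr_suml; apply: ler_sum => i _.
by rewrite ler_wpM2l.
Qed.

(** Farkas' lemma in the space of pairs (a, b): if no pair separates, then a x - b is a nonnegative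
    combination of the a p_i - b, and comparing coefficients of b shows that the weights sum to
    1. *)
Lemma polytope_separation k (p : 'I_k -> vec R m) x :
  ~ conv [set p i | i in [set: 'I_k]] x ->
  exists (a : vec R m) (b : R), (forall i, dot a (p i) <= b) /\ b < dot a x.
Proof.
move=> Lx; apply: contrapT => H; apply: Lx; apply/polytopeP.
pose X : lmodType R := (vec R m * R^o)%type.
pose f (y : vec R m) (w : X) : R := dot w.1 y - w.2.
have sf y : scalar (f y).
  move=> s u w; rewrite /f !(dotC _ y) /= dot_scalar.
  by rewrite (_ : s *: u.2 = s * u.2) //; ring.
have [|lam [lam0 e]] := farkas (fun i => sf (p i)) (sf x).
  move=> w hw; rewrite leNgt; apply/negP => wx; apply: H.
  exists w.1, w.2; split=> [i|]; last by rewrite -subr_gt0.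
  by have := hw i; rewrite /f subr_le0.
have lam1 : \sum_(i < k) lam i = 1.
  have z y : dot 0 y = 0 :> R by rewrite /dot big1 // => i _; rewrite mxE mul0r.
  have := e (0, -1); rewrite /f /= z sub0r opprK => ->.
  by apply: eq_bigr => i _; rewrite z add0r mulr1.
exists lam; split=> //; apply/rowP => j; rewrite summxE.
have := e (delta_mx 0 j, 0); rewrite /f /= subr0 dot_delta => ->.
by apply: eq_bigr => i _; rewrite subr0 dot_delta mxE.
Qed.

Lemma enorm_coord v i : `|v 0 i| <= enorm v.
Proof.
rewrite -sqrtr_sqr; apply: ler_wsqrtr; rewrite (bigD1 i) //= lerDl.
by apply: sumr_ge0 => j _; apply: sqr_ge0.
Qed.

Lemma enorm_ge0 v : 0 <= enorm v.
Proof. exact: sqrtr_ge0. Qed.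

Lemma enorm_le_norm1 v : enorm v <= norm1 v.
Proof.
rewrite -(ger0_norm (norm1_ge0 v)) -sqrtr_sqr; apply: ler_wsqrtr.
rewrite expr2 {1}/norm1 mulr_suml; apply: ler_sum => i _.
by rewrite -real_normK ?num_real // expr2 ler_wpM2l // norm1_coord.
Qed.

(* If no nonzero functional is maximal at [v], then Farkas' lemma writes every
   [+-e_j] as a conic combination of the [p i - v], so [v] is interior. *)
Lemma polytope_support k (p : 'I_k -> vec R m) v :
  conv [set p i | i in [set: 'I_k]] v ->
  ~ interior_pts (conv [set p i | i in [set: 'I_k]]) v ->
  exists2 a : vec R m, a != 0 & forall i, dot a (p i) <= dot a v.
Proof.
move=> Lv nint; apply: contrapT => H; apply: nint.
have cone y : exists lam : 'I_k -> R, (forall i, 0 <= lam i) /\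
    y = \sum_(i < k) lam i *: (p i - v).
  have sf (z : vec R m) : scalar (fun a => dot a z).
    by move=> s u w; rewrite !(dotC _ z) dot_scalar.
  have [|lam [lam0 e]] := farkas (fun i => sf (p i - v)) (sf y).
    move=> a ha; suff -> : a = 0 by rewrite /dot big1 // => i _; rewrite mxE mul0r.
    apply/eqP; apply: contrapT => /negP an0; apply: H; exists a => // i.
    by have := ha i; rewrite dotB subr_le0.
  exists lam; split=> //; apply/rowP => j; rewrite summxE -dot_delta e.
  by apply: eq_bigr => i _; rewrite dot_delta [RHS]mxE.
have /choice[lp hp] : forall j : 'I_m, exists lam : 'I_k -> R, (forall i, 0 <= lam i) /\
    delta_mx 0 j = \sum_(i < k) lam i *: (p i - v) by move=> j; apply: cone.
have /choice[ln hn] : forall j : 'I_m, exists lam : 'I_k -> R, (forall i, 0 <= lam i) /\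
    - delta_mx 0 j = \sum_(i < k) lam i *: (p i - v) by move=> j; apply: cone.
pose T := \sum_(j < m) \sum_(i < k) (lp j i + ln j i).
have T0 : 0 <= T.
  apply: sumr_ge0 => j _; apply: sumr_ge0 => i _.
  by rewrite addr_ge0 //; [have [] := hp j|have [] := hn j].
(* With coordinates of [y - v] at most [1 / (1 + T)], the coefficients [mu] of [y - v] sum to at
   most 1, so [y] mixes [v] with a point of the polytope. *)
exists (1 + T)^-1; split=> [|y yv]; first by rewrite invr_gt0; lra.
pose d j := (y - v) 0 j.
pose mu i := \sum_(j < m) (Num.max (d j) 0 * lp j i + Num.max (- d j) 0 * ln j i).
have mu0 i : 0 <= mu i.
  apply: sumr_ge0 => j _; rewrite addr_ge0 // mulr_ge0 ?le_max ?lexx ?orbT //.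
    by have [] := hp j.
  by have [] := hn j.
have yE : y - v = \sum_(i < k) mu i *: (p i - v).
  under eq_bigr do rewrite /mu scaler_suml.
  rewrite exchange_big /=.
  under eq_bigr => j _.
    under eq_bigr do rewrite scalerDl -!scalerA.
    rewrite big_split /= -!scaler_sumr.
    have [_ <-] := hp j; have [_ <-] := hn j.
    rewrite scalerN -scalerBl.
    have -> : Num.max (d j) 0 - Num.max (- d j) 0 = d j.
      by rewrite /Num.max !(fun_if, if_arg); do 2![case: ltP => ?]; lra.
    over.
  rewrite [LHS]row_sum_delta; apply: eq_bigr => j _; congr (_ *: _).
have mu1 : \sum_(i < k) mu i <= 1.
  have dl j : `|d j| <= (1 + T)^-1 by apply: le_trans (enorm_coord _ _) (ltW yv).
  rewrite exchange_big /=.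
  apply: (@le_trans _ _ ((1 + T)^-1 * T)); last first.
    by rewrite mulrC ler_pdivrMr; lra.
  rewrite mulr_sumr; apply: ler_sum => j _.
  rewrite mulr_sumr; apply: ler_sum => i _.
  rewrite mulrDr; have := dl j; rewrite ler_norml => /andP[dl1 dl2].
  apply: lerD; apply: ler_wpM2r.
  - by have [] := hp j.
  - by rewrite ge_max dl2 invr_ge0; lra.
  - by have [] := hn j.
  - by rewrite ge_max invr_ge0; lra.
set L := conv _ in Lv *.
have cL : convex_set L by rewrite /L convE; apply: hull_convex.
have [s0|sn0] := eqVneq (\sum_(i < k) mu i) 0.
  suff -> : y = v by [].
  apply/eqP; rewrite -subr_eq0 yE big1 // => i _.
  move/eqP: s0; rewrite psumr_eq0 // => /allP/(_ i).
  by rewrite mem_index_enum => /(_ isT) /eqP ->; rewrite scale0r.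
set s := \sum_(i < k) mu i in mu1 sn0.
have s0 : 0 <= s by apply: sumr_ge0.
have -> : y = (1 - s) *: v + s *: (\sum_(i < k) (mu i / s) *: p i).
  rewrite -[LHS](subrK v) yE.
  rewrite scaler_sumr.
  under [X in _ = _ + X]eq_bigr do rewrite scalerA mulrC divfK //.
  have -> : \sum_(i < k) mu i *: (p i - v) = \sum_(i < k) mu i *: p i - s *: v.
    by rewrite scaler_suml -sumrB; apply: eq_bigr => i _; rewrite scalerBr.
  by rewrite scalerBl scale1r addrC addrA addrAC.
apply: cL; rewrite ?s0 //.
apply/polytopeP; exists (fun i => mu i / s); split=> // [i|].
  by rewrite divr_ge0.
by rewrite -mulr_suml divff.
Qed.

End Polytope.

(** * Integral solutions of rational systems; integral face inequalities *)

Lemma rat_vec_denominator (N : nat) (w : 'rV[rat]_N) :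
  exists (D : nat) (z : 'rV[int]_N), (0 < D)%N /\ forall j, D%:R * w 0 j = (z 0 j)%:~R.
Proof.
pose d j : int := denq (w 0 j).
pose P := \prod_j d j.
have P0 : 0 < P by apply: prodr_gt0 => j _; apply: denq_gt0.
exists `|P|%N, (\row_j (numq (w 0 j) * \prod_(i | i != j) d i)).
split=> [|j]; first by rewrite absz_gt0 gt_eqF.
rewrite mxE -[_%:R]/((Posz `|P|%N)%:~R) gtz0_abs // /P.
rewrite (bigD1 j) //= !intrM -[w 0 j in LHS]divq_num_den -/(d j).
by field; rewrite intr_eq0 denq_neq0.
Qed.

(* The infeasibility certificate of the rational system would also certify
   infeasibility over the reals. *)
Lemma rational_solution (R : realType) (N n : nat) (A : 'I_n -> 'rV[rat]_N)
    (B : 'rV[rat]_N) (w : 'rV[R]_N) :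
  (forall i, \sum_j w 0 j * ratr (A i 0 j) <= 0) ->
  0 < \sum_j w 0 j * ratr (B 0 j) ->
  exists z : 'rV[int]_N,
    (forall i, \sum_j (z 0 j)%:~R * (ratr (A i 0 j) : R) <= 0) /\
    0 < \sum_j (z 0 j)%:~R * (ratr (B 0 j) : R).
Proof.
move=> wA wB.
pose f (a w : 'rV[rat]_N) : rat := \sum_j w 0 j * a 0 j.
have sf a : scalar (f a).
  move=> s u v; rewrite /f mulr_sumr -big_split /=; apply: eq_bigr => j _.
  by rewrite !mxE; ring.
have [|] := pselect (forall x, (forall i, f (A i) x <= 0) -> f B x <= 0).
  move=> /(farkas (fun i => sf (A i)) (sf B))[lam [lam0 e]].
  suff : \sum_j w 0 j * ratr (B 0 j) <= 0 by rewrite leNgt wB.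
  have fd (a : 'rV[rat]_N) j : f a (delta_mx 0 j) = a 0 j.
    rewrite /f (bigD1 j) //= big1 ?addr0; first by rewrite mxE !eqxx mul1r.
    by move=> i ij; rewrite mxE eqxx /= (negPf ij) mul0r.
  have Bj j : B 0 j = \sum_i lam i * A i 0 j.
    by rewrite -[LHS]fd e; apply: eq_bigr => i _; rewrite fd.
  have -> : \sum_j w 0 j * ratr (B 0 j) =
      \sum_i ratr (lam i) * \sum_j w 0 j * ratr (A i 0 j) :> R.
    under [RHS]eq_bigr do rewrite mulr_sumr.
    rewrite exchange_big /=; apply: eq_bigr => j _.
    rewrite Bj rmorph_sum mulr_sumr /=; apply: eq_bigr => i _.
    by rewrite rmorphM /=; ring.
  apply: sumr_le0 => i _; apply: mulr_ge0_le0 => //.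
  by rewrite ler0q.
move=> /existsNP[x /not_implyP[hA /negP]]; rewrite -ltNge => hB.
have [D [z [D0 Dz]]] := rat_vec_denominator x.
have E (a : 'rV[rat]_N) :
    \sum_j (z 0 j)%:~R * (ratr (a 0 j) : R) = ratr (D%:R * f a x).
  rewrite /f mulr_sumr rmorph_sum /=; apply: eq_bigr => j _.
  by rewrite mulrA Dz rmorphM /= ratr_int.
exists z; split=> [i|]; rewrite E ?lerq0 ?ltr0q.
  by rewrite pmulr_rle0 ?ltr0n.
by rewrite mulr_gt0 ?ltr0n.
Qed.

(** The conditions on [(pi, pi0)] form a homogeneous rational system, where each tight point also
    contributes the opposite inequality. The pair [(a, b)] solves it over the reals, so an integral
    solution exists. *)
Lemma rational_face (R : realType) (m k : nat) (p : 'I_k -> vec R m) (a : vec R m) (b : R) i0 :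
  (forall i, is_rat_vec (p i)) -> (forall i, dot a (p i) <= b) -> dot a (p i0) < b ->
  exists (pi : 'rV[int]_m) (pi0 : int),
    [/\ forall i, dotZ pi (p i) <= pi0%:~R,
        forall i, dot a (p i) = b -> dotZ pi (p i) = pi0%:~R
      & dotZ pi (p i0) < pi0%:~R].
Proof.
move=> /choice[q pq] pb p0.
pose T i := dot a (p i) == b.
pose h i : 'rV[rat]_(m + 1) := row_mx (q i) (- 1)%:M.
pose A (i : 'I_(k + k)) := match fintype.split i with
  | inl j => h j | inr j => if T j then - h j else 0 end.
have sl (j : 'I_k) : fintype.split (lshift k j) = inl j by apply: (unsplitK (inl j)).
have sr (j : 'I_k) : fintype.split (rshift k j) = inr j by apply: (unsplitK (inr j)).
have hE (F : 'I_(m + 1) -> R) i :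
    \sum_j F j * ratr (h i 0 j) = \sum_(j < m) F (lshift 1 j) * p i 0 j - F (rshift m ord0).
  rewrite big_split_ord /= big_ord1 row_mxEr mxE eqxx mulr1n rmorphN1 mulrN1.
  by congr (_ - _); apply: eq_bigr => j _; rewrite row_mxEl pq mxE.
have AE (F : 'I_(m + 1) -> R) i :
    \sum_j F j * ratr ((- h i) 0 j) = - \sum_j F j * ratr (h i 0 j).
  by rewrite -sumrN; apply: eq_bigr => j _; rewrite mxE rmorphN mulrN.
pose w : 'rV[R]_(m + 1) := row_mx a b%:M.
have wE i : \sum_j w 0 j * ratr (h i 0 j) = dot a (p i) - b.
  rewrite hE row_mxEr mxE eqxx mulr1n; congr (_ - _).
  by apply: eq_bigr => j _; rewrite row_mxEl.
have [||z [zA zB]] := @rational_solution R _ _ A (- h i0) w.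
- move=> i; rewrite /A; case: fintype.split => j.
    by rewrite wE subr_le0.
  case: ifP => [/eqP Tj|_]; first by rewrite AE wE Tj subrr oppr0.
  by rewrite big1 // => l _; rewrite [X in ratr X]mxE raddf0 mulr0.
- by rewrite AE wE oppr_gt0 subr_lt0.
pose pi : 'rV[int]_m := \row_j z 0 (lshift 1 j).
pose pi0 := z 0 (rshift m ord0).
have zE i : \sum_j (z 0 j)%:~R * ratr (h i 0 j) = dotZ pi (p i) - pi0%:~R.
  by rewrite hE; congr (_ - _); apply: eq_bigr => j _; rewrite mxE.
have le i : dotZ pi (p i) <= pi0%:~R.
  by have := zA (lshift k i); rewrite /A sl zE subr_le0.
exists pi, pi0; split=> // [i Ti|].
  apply/eqP; rewrite eq_le le /=.
  by have := zA (rshift k i); rewrite /A sr /T Ti eqxx AE zE oppr_le0 subr_ge0.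
by have := zB; rewrite AE zE oppr_gt0 subr_lt0.
Qed.

(** * Finiteness of boxes and uniform thresholds *)

Lemma int_box_finite (m B : nat) :
  exists V : seq 'rV[int]_m, forall z : 'rV[int]_m, (forall i, `|z 0 i| <= B%:Z) -> z \in V.
Proof.
exists [seq \row_i (Posz (f i) - B%:Z) | f : {ffun 'I_m -> 'I_(B + B).+1}].
move=> z zB; apply/fintype.imageP.
exists [ffun i : 'I_m => inord (absz (z 0 i + B%:Z)%R) : 'I_(B + B).+1] => //.
apply/rowP => i; rewrite mxE ffunE inordK.
  by move: (zB i); rewrite ler_norml; move: (z 0 i) => x; lia.
by move: (zB i); rewrite ler_norml; move: (z 0 i) => x; lia.
Qed.

(** Serves to add a small multiple of a second affine function without destroying finitely many
    strict inequalities. *)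
Lemma eventually_positive (R : realType) (T : eqType) (s : seq T) (A B : T -> R) :
  (forall x, x \in s -> 0 < A x) ->
  exists N0, forall N, (N0 <= N)%N -> forall x, x \in s -> 0 < A x + B x / N.+1%:R.
Proof.
elim: s => [|y s IH] As; first by exists 0%N.
have [|N1 h1] := IH; first by move=> x xs; apply: As; rewrite inE xs orbT.
have Ay : 0 < A y by apply: As; rewrite mem_head.
exists (maxn N1 (Num.truncn (`|B y| / A y)).+1) => N; rewrite geq_max => /andP[N1N N2N] x.
rewrite inE => /predU1P[->|xs]; last exact: h1.
have N0 : 0 < N.+1%:R :> R by rewrite ltr0n.
have : `|B y| / A y < N.+1%:R.
  by apply: lt_le_trans (truncnS_gt _) _; rewrite ler_nat (leq_trans N2N).
rewrite ltr_pdivrMr // => h.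
have := ler_norm (- B y); rewrite normrN => h'.
rewrite -(pmulr_lgt0 _ N0) mulrDl divfK ?gt_eqF //.
lra.
Qed.

(** * Distance to a set, diameter and interior points *)

Section Distance.
Variables (R : realType) (m : nat).
Implicit Types (a x y : vec R m) (L : set (vec R m)).

Lemma norm1D x y : norm1 (x + y) <= norm1 x + norm1 y.
Proof.
by rewrite /norm1 -big_split /=; apply: ler_sum => i _; rewrite mxE ler_normD.
Qed.

Lemma norm1Z (t : R) x : norm1 (t *: x) = `|t| * norm1 x.
Proof. by rewrite /norm1 mulr_sumr; apply: eq_bigr => i _; rewrite mxE normrM. Qed.

Lemma norm1_eq0 x : norm1 x = 0 -> x = 0.
Proof.
move=> h; apply/rowP => i; apply/eqP; rewrite mxE -normr_le0 -h.
exact: norm1_coord.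
Qed.

Lemma dist_set_ge L x r : L !=set0 -> (forall y, L y -> r <= enorm (x - y)) ->
  r <= dist_set x L.
Proof.
move=> [y Ly] h; apply: lb_le_inf; first by exists (enorm (x - y)), y.
by move=> _ [z Lz <-]; apply: h.
Qed.

Lemma dist_set_valid L a (b : R) x : L !=set0 -> (forall y, L y -> dot a y <= b) ->
  dot a x - b <= norm1 a * dist_set x L.
Proof.
move=> L0 ab.
have h y : L y -> dot a x - b <= norm1 a * enorm (x - y).
  move=> Ly; apply: (@le_trans _ _ (dot a (x - y))).
    by rewrite dotB lerB // ab.
  apply: le_trans (ler_norm _) _; apply: dot_le_norm1 => i; exact: enorm_coord.
have [a0|an0] := eqVneq (norm1 a) 0.
  by have [y Ly] := L0; have := h y Ly; rewrite a0 !mul0r.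
have ap : 0 < norm1 a by rewrite lt_def an0 norm1_ge0.
rewrite mulrC -ler_pdivrMr //; apply: dist_set_ge => // y Ly.
by rewrite ler_pdivrMr // mulrC h.
Qed.

Lemma dist_set_ge0 L x : L !=set0 -> 0 <= dist_set x L.
Proof. by move=> L0; apply: dist_set_ge => // y _; apply: enorm_ge0. Qed.

Lemma dist_set_norm1 L (B : R) x : (0 < m)%N -> L !=set0 ->
  (forall y, L y -> norm1 y <= B) -> norm1 x - B <= m%:R * dist_set x L.
Proof.
move=> m0 L0 hB; rewrite mulrC -ler_pdivrMr ?ltr0n //.
apply: dist_set_ge => // y Ly; rewrite ler_pdivrMr ?ltr0n //.
have h1 : norm1 x <= norm1 (x - y) + norm1 y by rewrite -{1}(subrK y x) norm1D.
have h2 : norm1 (x - y) <= enorm (x - y) * m%:R.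
  rewrite /norm1 mulr_natr -[m in _ *+ m]card_ord -sumr_const.
  by apply: ler_sum => i _; apply: enorm_coord.
by have := hB y Ly; lra.
Qed.

Lemma polytope_norm1_bounded k (p : 'I_k -> vec R m) :
  exists2 B : R, 0 <= B & forall y, conv [set p i | i in [set: 'I_k]] y -> norm1 y <= B.
Proof.
exists (\sum_(i < k) norm1 (p i)) => [|y].
  by apply: sumr_ge0 => i _; apply: norm1_ge0.
rewrite convE; pose W : set (vec R m) := [set x | norm1 x <= \sum_(i < k) norm1 (p i)].
apply: (@convex_set_hull _ _ W) => [u v t tt /= hu hv|_ [i _ <-]].
  case/andP: tt => t0 t1; rewrite /W /= in hu hv *; apply: le_trans (norm1D _ _) _.
  rewrite !norm1Z !ger0_norm ?subr_ge0 //.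
  by rewrite -subr_ge0 in t1; have := ler_wpM2l t0 hv; have := ler_wpM2l t1 hu; lra.
rewrite /W /= (bigD1 i) //= lerDl.
by apply: sumr_ge0 => j _; apply: norm1_ge0.
Qed.

Lemma interior_shift L x a : interior_pts L x ->
  exists2 t : R, 0 < t & L (x + t *: a).
Proof.
move=> [e [e0 h]].
have n0 := norm1_ge0 a.
exists (e / (1 + norm1 a)); first by rewrite divr_gt0 //; lra.
apply: h; rewrite addrC addKr; apply: le_lt_trans (enorm_le_norm1 _) _.
rewrite norm1Z gtr0_norm ?divr_gt0 //; last lra.
rewrite -mulrA gtr_pMr //.
by rewrite mulrC ltr_pdivrMr; lra.
Qed.

Lemma interior_sub L x : interior_pts L x -> L x.
Proof.
move=> [e [e0 h]]; apply: h; rewrite subrr /enorm big1 ?sqrtr0 // => i _.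
by rewrite mxE expr0n.
Qed.

(** A small step from [x] in direction [a] stays in [L] and increases the functional by a positive
    multiple of [dot a a]. *)
Lemma interior_lt L a (b : R) x : a != 0 -> (forall y, L y -> dot a y <= b) ->
  interior_pts L x -> dot a x < b.
Proof.
move=> an0 ab /(interior_shift a)[t t0 /ab].
rewrite dotD dotZr; apply: lt_le_trans; rewrite ltrDl mulr_gt0 //.
rewrite lt_def; apply/andP; split; last by apply: sumr_ge0 => i _; rewrite -expr2 sqr_ge0.
apply: contra an0 => /eqP h; apply/eqP/rowP => i; apply/eqP.
rewrite mxE -sqrf_eq0 expr2; move/eqP: h; rewrite /dot psumr_eq0.
  by move=> /allP/(_ i); rewrite mem_index_enum => /(_ isT).
by move=> j _; rewrite -expr2 sqr_ge0.
Qed.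

Lemma diam_gt0 L (B : R) : (0 < m)%N -> full_dimensional L ->
  (forall y, L y -> norm1 y <= B) -> 0 < diam L.
Proof.
move=> m0 [x xint] hB; pose i0 := Ordinal m0.
have [t t0 Lt] := interior_shift (delta_mx 0 i0) xint.
have Lx := interior_sub xint.
apply: (@lt_le_trans _ _ (enorm (x + t *: delta_mx 0 i0 - x))).
  apply: lt_le_trans (enorm_coord _ i0).
  by rewrite addrC addKr !mxE !eqxx mulr1 normr_gt0 gt_eqF.
apply: ub_le_sup; last by exists (x + t *: delta_mx 0 i0), x.
exists (B + B) => _ [u [v [Lu [Lv ->]]]].
apply: le_trans (enorm_le_norm1 _) _; apply: le_trans (norm1D _ _) _.
by rewrite -[norm1 (- v)]mul1r -{1}(normrN1 R) -norm1Z scaleN1r opprK lerD // hB.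
Qed.

End Distance.

(** * Convexity and closedness of polyhedra *)

Section Polyhedron.
Variables (R : realType) (m : nat) (Q : set (vec R m * R)).

Lemma polyhedron2_convex : polyhedron2 Q -> convex_set (U := (vec R m * R^o)%type) Q.
Proof.
move=> [k [A [c [b ->]]]] u v t /andP[t0 t1] hu hv j /=.
rewrite dotD !dotZr (_ : (1 - t) *: u.2 = (1 - t) * u.2) // (_ : t *: v.2 = t * v.2) //.
rewrite -subr_ge0 in t1.
by have := ler_wpM2l t0 (hv j); have := ler_wpM2l t1 (hu j); lra.
Qed.

Lemma polyhedron2_closed : polyhedron2 Q -> closed_pts Q.
Proof.
move=> [k [A [c [b ->]]]] x z h j /=; apply/ler_addgt0Pr => eps eps0.
have N0 : 0 < 1 + norm1 (A j) + `|c j|.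
  by have := norm1_ge0 (A j); have := normr_ge0 (c j); lra.
pose eta := eps / (1 + norm1 (A j) + `|c j|).
have eta0 : 0 < eta by rewrite divr_gt0.
have [p [/(_ j) Qp px pz]] := h _ eta0.
have h1 : `|dot (A j) (p.1 - x)| <= norm1 (A j) * eta.
  by apply: dot_le_norm1 => i; rewrite !mxE; apply: px.
have h2 : `|c j * (p.2 - z)| <= `|c j| * eta by rewrite normrM ler_wpM2l.
have e : eps = eta + norm1 (A j) * eta + `|c j| * eta.
  by rewrite /eta; field; rewrite gt_eqF.
move: h1 h2; rewrite dotB mulrBr !ler_norml; lra.
Qed.

End Polyhedron.

(** The weighted slacks sum to zero, so only generators tight for [a] carry weight. *)
Lemma polytope_tight (R : realType) (m k : nat) (p : 'I_k -> vec R m) (a a' : vec R m)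
    (b b' : R) x :
  (forall i, dot a (p i) <= b) -> (forall i, dot a (p i) = b -> dot a' (p i) = b') ->
  conv [set p i | i in [set: 'I_k]] x -> dot a x = b -> dot a' x = b'.
Proof.
move=> le tight /polytopeP[lam [lam0 lam1 ->]]; rewrite !dot_sumr => e.
have : \sum_(i < k) lam i * (b - dot a (p i)) = 0.
  by under eq_bigr do rewrite mulrBr; rewrite sumrB e -mulr_suml lam1 mul1r subrr.
move/eqP; rewrite psumr_eq0; last by move=> i _; rewrite mulr_ge0 // subr_ge0.
move=> /allP h; rewrite -[b']mul1r -lam1 mulr_suml; apply: eq_bigr => i _.
have := h i (mem_index_enum _); rewrite mulf_eq0 => /orP[/eqP ->|].
  by rewrite !mul0r.
by rewrite subr_eq0 => /eqP/esym /tight ->.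
Qed.

(** * Rational affine functions with integral numerators *)

Section IntegralCut.
Variables (R : realType) (m : nat).
Implicit Types (D N : nat) (pi al : 'rV[int]_m) (b be : int).

(** The function l of the overview, written over a common denominator so that its numerator directly
    supplies the integral vector of a split. *)
Definition cut D pi b (x : vec R m) : R := (b%:~R - dotZ pi x) / D%:R.

Definition cut_slope D pi : vec R m := - (D%:R^-1 : R) *: intv R pi.

Definition small_cut (eta : R) D pi b :=
  `|b%:~R / D%:R| < eta /\ forall i, `|cut_slope D pi 0 i| < eta.

Lemma cutE D pi b x : cut D pi b x = b%:~R / D%:R + dot (cut_slope D pi) x.
Proof. by rewrite /cut dotZE /cut_slope [dot (_ *: _) _]dotC dotZr [dot x _]dotC; ring. Qed.

(** Numerator of the sum of two cuts over the denominator [D * N]. *)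
Definition cut_add D N pi al : 'rV[int]_m := N%:Z *: pi + D%:Z *: al.

Lemma intv_cut_add D N pi al :
  intv R (cut_add D N pi al) = N%:R *: intv R pi + D%:R *: intv R al.
Proof. by apply/rowP => i; rewrite !mxE intrD !intrM. Qed.

Lemma cutD D N pi al b be x : (0 < D)%N -> (0 < N)%N ->
  cut (D * N) (cut_add D N pi al) (N%:Z * b + D%:Z * be) x = cut D pi b x + cut N al be x.
Proof.
move=> D0 N0; rewrite /cut !dotZE intv_cut_add.
rewrite [dot (_ + _) _]dotC dotD !dotZr ![dot x _]dotC intrD !intrM natrM -!pmulrn.
by field; rewrite !pnatr_eq0 -!lt0n N0.
Qed.

Lemma dotZN al x : dotZ (- al) x = - dotZ al x :> R.
Proof. by rewrite /dotZ -sumrN; apply: eq_bigr => i _; rewrite mxE intrN mulNr. Qed.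

Lemma cutN D pi b x : cut D (- pi) (- b) x = - cut D pi b x.
Proof. by rewrite /cut dotZN intrN; ring. Qed.

Lemma cut_slopeD D N pi al : (0 < D)%N -> (0 < N)%N ->
  cut_slope (D * N) (cut_add D N pi al) = cut_slope D pi + cut_slope N al.
Proof.
move=> D0 N0; rewrite /cut_slope intv_cut_add; apply/rowP => i; rewrite !mxE natrM.
by field; rewrite !pnatr_eq0 -!lt0n N0.
Qed.

Lemma cut_ge0 D pi b x : (0 < D)%N -> (0 <= cut D pi b x) = (dotZ pi x <= b%:~R).
Proof. by move=> D0; rewrite /cut pmulr_lge0 ?invr_gt0 ?ltr0n // subr_ge0. Qed.

Lemma cut_eq0 D pi b x : (0 < D)%N -> (cut D pi b x == 0) = (dotZ pi x == b%:~R).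
Proof.
move=> D0; rewrite /cut mulf_eq0 invr_eq0 pnatr_eq0 -[D == _]negbK -lt0n D0 orbF.
by rewrite subr_eq0 eq_sym.
Qed.

Lemma eventually_norm_lt (T : eqType) (s : seq T) (eta : R) (A B : T -> R) :
  (forall t, t \in s -> `|A t| < eta) ->
  exists N0, forall N, (N0 <= N)%N -> forall t, t \in s -> `|A t + B t / N.+1%:R| < eta.
Proof.
move=> As.
have [|N1 h1] := @eventually_positive R T s (fun t => eta - A t) (fun t => - B t).
  by move=> t /As; rewrite ltr_norml subr_gt0 => /andP[].
have [|N2 h2] := @eventually_positive R T s (fun t => eta + A t) B.
  by move=> t /As; rewrite ltr_norml => /andP[? _]; lra.
exists (maxn N1 N2) => N; rewrite geq_max => /andP[/h1 {}h1 /h2 {}h2] t ts.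
rewrite ltr_norml; have := h1 t ts; have := h2 t ts.
by rewrite /= mulNr; move: (B t / _) => r; lra.
Qed.

Lemma small_cutD eta D pi b al be : (0 < D)%N -> small_cut eta D pi b ->
  exists N0, forall N, (N0 <= N)%N ->
    small_cut eta (D * N.+1) (cut_add D N.+1 pi al) (N.+1%:Z * b + D%:Z * be).
Proof.
move=> D0 [sb sp].
have [|N1 h1] := @eventually_norm_lt _ [:: tt] eta (fun=> b%:~R / D%:R) (fun=> be%:~R).
  by move=> [].
have [|N2 h2] := @eventually_norm_lt _ (enum 'I_m) eta (fun i => cut_slope D pi 0 i)
  (fun i => - (al 0 i)%:~R).
  by move=> i _; apply: sp.
exists (maxn N1 N2) => N; rewrite geq_max => /andP[/h1 {}h1 /h2 {}h2]; split=> [|i].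
  have := h1 tt (mem_head _ _); congr (`| _ | < _).
  rewrite intrD !intrM natrM -!pmulrn.
  by field; rewrite nat1r !pnatr_eq0 -!lt0n D0.
rewrite cut_slopeD // mxE; have := h2 i (mem_enum _ _); congr (`| _ + _ | < _).
by rewrite !mxE mulrC mulrN mulNr mulrC.
Qed.

Lemma small_cut_large eta al be : 0 < eta ->
  exists N0, forall N, (N0 <= N)%N -> small_cut eta N.+1 al be.
Proof.
move=> eta0; have [|N0 h] := @small_cutD eta 1 0 0 al be isT.
  by split=> [|i]; rewrite ?mul0r ?normr0 // !mxE mulr0 normr0.
exists N0 => N /h [h1 h2]; split=> [|i].
  by move: h1; rewrite mulr0 add0r mul1r mul1n.
by have := h2 i; rewrite cut_slopeD // !mxE mulr0 add0r.
Qed.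

End IntegralCut.

(** Provides the decrease of the number of integer zeros in the main induction. *)
Lemma count_lt (T : eqType) (s : seq T) (P P' : pred T) x :
  (forall y, y \in s -> P' y -> P y) -> x \in s -> P x -> ~~ P' x ->
  (count P' s < count P s)%N.
Proof.
move=> sub xs Px nP'x; rewrite -!size_filter.
have sz : subseq [seq y <- s | P' y] [seq y <- s | P y].
  have -> : [seq y <- s | P' y] = [seq y <- [seq y <- s | P y] | P' y].
    rewrite -filter_predI; apply: eq_in_filter => y ys /=.
    by case P'y: (P' y) => //=; rewrite sub.
  exact: filter_subseq.
rewrite ltn_neqAle (size_subseq sz) andbT; apply/negP => /eqP e.
have /eqP E : [seq y <- s | P' y] == [seq y <- s | P y].
  by rewrite -(size_subseq_leqif sz) e.
have : x \in [seq y <- s | P y] by rewrite mem_filter Px.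
by rewrite -E mem_filter (negPf nP'x).
Qed.

(** * Heights over [L], and the induction on integer zeros *)

Section Relaxation.
Variables (R : realType) (m k : nat) (pt : 'I_k -> vec R m) (M M0 : R).
Variable Q : set (vec R m * R).
Let L : set (vec R m) := conv [set pt i | i in [set: 'I_k]].
Hypothesis m_gt0 : (0 < m)%N.
Hypothesis L_full : full_dimensional L.
Hypothesis L_free : lattice_free L.
Hypothesis ltM : M0 < M.
Hypothesis QR : Q `<=` Rset L M M0.

Let c := (M - M0) / diam L.

Let L_neq0 : L !=set0.
Proof. by have [x /interior_sub] := L_full; exists x. Qed.

Let c_gt0 : 0 < c.
Proof.
have [B _ hB] := polytope_norm1_bounded pt.
by rewrite divr_gt0 ?subr_gt0 // (diam_gt0 m_gt0 L_full hB).
Qed.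

Lemma height_outside p : Q p -> ~ interior_pts L p.1 -> p.2 <= M0 - c * dist_set p.1 L.
Proof.
move=> /QR; rewrite /Rset; case: asboolP => // _ + _.
by rewrite (_ : _ / _ * _ = c * dist_set p.1 L) // /c; ring.
Qed.

Lemma height_inside p : Q p -> interior_pts L p.1 -> p.2 <= M.
Proof. by move=> /QR; rewrite /Rset; case: asboolP. Qed.

Lemma height_integer p : Q p -> is_int_vec p.1 -> p.2 <= M0.
Proof.
move=> Qp ip; apply: le_trans (height_outside Qp (fun h => L_free h ip)) _.
by rewrite lerBlDr lerDl mulr_ge0 ?(ltW c_gt0) // dist_set_ge0.
Qed.

(** Outside [L] the bound falls at rate [c] in Euclidean distance, hence at rate [c / m] in
    [norm1]. *)
Lemma height_coercive : exists C c' : R, 0 < c' /\ coercive Q C c'.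
Proof.
have [B B0 hB] := polytope_norm1_bounded pt.
pose c' := c / m%:R.
have c'0 : 0 < c' by rewrite divr_gt0 ?ltr0n.
exists (M + c' * B), c'; split=> // p Qp.
have [pint|pint] := pselect (interior_pts L p.1).
  have := height_inside Qp pint; have := hB _ (interior_sub pint).
  by rewrite -(ler_pM2l c'0); lra.
have e : c' * (m%:R * dist_set p.1 L) = c * dist_set p.1 L.
  by rewrite mulrA divfK // pnatr_eq0 -lt0n.
have := ler_wpM2l (ltW c'0) (dist_set_norm1 p.1 m_gt0 L_neq0 hB); rewrite e.
by have := height_outside Qp pint; have := ltM; lra.
Qed.

(** Points with [b <= dot a x] are not interior, and their distance to [L] is at least
    [(dot a x - b) / norm1 a]. *)
Lemma height_valid (a : vec R m) (b : R) : a != 0 -> (forall y, L y -> dot a y <= b) ->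
  exists2 kap : R, 0 < kap &
    forall p, Q p -> b <= dot a p.1 -> p.2 <= M0 - kap * (dot a p.1 - b).
Proof.
move=> an0 ab.
have a0 : 0 < norm1 a.
  by rewrite lt_def norm1_ge0 andbT; apply: contra an0 => /eqP/norm1_eq0 ->.
exists (c / norm1 a) => [|p Qp bp]; first by rewrite divr_gt0.
have nint : ~ interior_pts L p.1.
  by move=> /(interior_lt an0 ab); rewrite ltNge bp.
apply: le_trans (height_outside Qp nint) _.
rewrite lerD2l lerN2 -mulrA ler_pM2l // ler_pdivrMl //.
exact: dist_set_valid.
Qed.

(** Far from [L] the bound on z falls faster than a function of small slope; near [L] there are
    finitely many integer points outside, all at positive distance. *)
Lemma height_integer_outside : exists2 eta : R, 0 < eta &
  forall (g : vec R m) (g0 : R), `|g0| < eta -> (forall i, `|g 0 i| < eta) ->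
  forall p, Q p -> is_int_vec p.1 -> ~ L p.1 -> p.2 < M0 + (g0 + dot g p.1).
Proof.
have [B B0 hB] := polytope_norm1_bounded pt.
have [V hV] := int_box_finite m (Num.truncn (B + B + 1)).
have [del del0 hdel] : exists2 del : R, 0 < del &
    forall z, z \in V -> ~ L (intv R z) -> del <= c * dist_set (intv R z) L.
  elim: V {hV} => [|z V [del del0 IH]]; first by exists 1.
  have [Lz|Lz] := pselect (L (intv R z)).
    by exists del => // y; rewrite inE => /predU1P[->//|]; apply: IH.
  have [a [b [ab bz]]] := polytope_separation Lz.
  have dz : 0 < c * dist_set (intv R z) L.
    rewrite mulr_gt0 //.
    have := dist_set_valid (intv R z) L_neq0 (fun y => polytope_le ab (x := y)).
    have a0 := norm1_ge0 a.
    rewrite ltNge => h; apply/negP => d0.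
    have : norm1 a * dist_set (intv R z) L <= 0 by apply: mulr_ge0_le0.
    lra.
  exists (Num.min del (c * dist_set (intv R z) L)); first by rewrite lt_min del0.
  move=> y; rewrite inE => /predU1P[->|yV] nL; rewrite ge_min ?lexx ?orbT //.
  by rewrite IH.
pose c' := c / m%:R.
have c'0 : 0 < c' by rewrite divr_gt0 ?ltr0n.
(* The first term handles [norm1] at least [B + B + 1], the second the remaining points, where
   [1 + norm1] is at most [B + B + 2]. *)
pose eta := Num.min (c' / 2) (del / (B + B + 2)).
have B2 : 0 < B + B + 2 by lra.
have eta0 : 0 < eta by rewrite lt_min; apply/andP; split; apply: divr_gt0.
have eta1 : eta <= c' / 2 by rewrite ge_min lexx.
have eta2 : eta * (B + B + 2) <= del.
  by rewrite -ler_pdivlMr // ge_min lexx orbT.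
exists eta => // g g0 hg0 hg p Qp ip nL.
have nint : ~ interior_pts L p.1 by move=> /interior_sub.
apply: le_lt_trans (height_outside Qp nint) _.
rewrite ltrD2l.
have n0 := norm1_ge0 p.1.
have hdot : `|dot g p.1| <= eta * norm1 p.1.
  apply: le_trans (ler_norm_sum _ _ _) _; rewrite /norm1 mulr_sumr.
  by apply: ler_sum => i _; rewrite normrM ler_wpM2r // ltW.
have small : - (eta + eta * norm1 p.1) < g0 + dot g p.1.
  by move: hg0 hdot; rewrite ltr_norml ler_norml; lra.
apply: le_lt_trans small; rewrite lerN2.
have [big|sm] := leP (B + B + 1) (norm1 p.1).
  have e : c' * (m%:R * dist_set p.1 L) = c * dist_set p.1 L.
    by rewrite mulrA divfK // pnatr_eq0 -lt0n.
  have := ler_wpM2l (ltW c'0) (dist_set_norm1 p.1 m_gt0 L_neq0 hB); rewrite e.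
  have : eta * (1 + norm1 p.1) <= c' / 2 * (1 + norm1 p.1) by rewrite ler_wpM2r //; lra.
  have : c' * (B + B + 1) <= c' * norm1 p.1 by rewrite ler_wpM2l // ltW.
  lra.
have [z pz] := ip.
have zV : z \in V.
  apply: hV => i.
  have : `|p.1 0 i| < B + B + 1 by apply: le_lt_trans (norm1_coord _ _) sm.
  rewrite pz mxE -intr_norm => h.
  have : `|z 0 i| < (Num.truncn (B + B + 1)).+1%:Z.
    by rewrite -(ltr_int R); apply: lt_trans h _; apply: truncnS_gt.
  by rewrite intS addrC ltzD1.
have := hdel z zV; rewrite -[intv R z]/(map_mx _ z) -pz => /(_ nL).
have : eta * (1 + norm1 p.1) <= eta * (B + B + 2) by rewrite ler_pM2l //; lra.
lra.
Qed.

Hypothesis cQ : convex_set (U := (vec R m * R^o)%type) Q.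
Hypothesis clQ : closed_pts Q.

(** At integer points of [Q] in [L], z is at most [M0] and the affine function is nonnegative, so
    equality forces a zero; outside [L] the inequality is strict. These are the hypotheses of
    [split_limit]. *)
Lemma split_limit_integer : exists2 eta : R, 0 < eta &
  forall (g : vec R m) (g0 : R) (gam : vec R m) (b : R),
  `|g0| < eta -> (forall i, `|g 0 i| < eta) ->
  (forall z, L (intv R z) -> 0 <= g0 + dot g (intv R z)) ->
  (forall z, L (intv R z) -> g0 + dot g (intv R z) = 0 -> dot gam (intv R z) < b) ->
  exists q, forall p, rank_split_closure q Q p -> b <= dot gam p.1 ->
    p.2 <= M0 + (g0 + dot g p.1).
Proof.
have [C [c' [c'0 coer]]] := height_coercive.
have [eta eta0 heta] := height_integer_outside.
exists (Num.min eta (c' / 2)) => [|g g0 gam b].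
  by rewrite lt_min eta0 divr_gt0.
rewrite lt_min => /andP[g0e _] ge pos zero.
have gc i : `|g 0 i| <= c' / 2 by have := ge i; rewrite lt_min => /andP[_ /ltW].
have ge' i : `|g 0 i| < eta by have := ge i; rewrite lt_min => /andP[].
have out := heta g g0 g0e ge'.
apply: (split_limit cQ clQ c'0 coer gc) => p Qp ip.
  have [Lp|/(out p Qp ip)/ltW//] := pselect (L p.1).
  have := height_integer Qp ip; have [z pz] := ip.
  by rewrite pz in Lp *; have := pos _ Lp; rewrite /intv; lra.
have [Lp|/(out p Qp ip) lt e] := pselect (L p.1); last by move: lt; rewrite e ltxx.
have := height_integer Qp ip; have [z pz] := ip.
rewrite pz in Lp *; have := pos _ Lp; rewrite /intv => h1 h2 h3.
by apply: zero => //; rewrite /intv; lra.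
Qed.


Hypothesis pt_rat : forall i, is_rat_vec (pt i).
Hypothesis L_2hp : two_hyperplane_property L.

Let K q := rank_split_closure q Q.

Let K_decr n n' : (n <= n')%N -> K n' `<=` K n.
Proof. exact: rank_split_closure_decr. Qed.

(** The limit argument as a property of [eta], which is fixed before the induction; every cut built
    later must remain [small_cut eta]. *)
Definition limit_cuts (eta : R) :=
  forall D pi b (gam : vec R m) (be : R), small_cut eta D pi b ->
    (forall z, L (intv R z) -> 0 <= cut D pi b (intv R z)) ->
    (forall z, L (intv R z) -> cut D pi b (intv R z) = 0 -> dot gam (intv R z) < be) ->
    exists q, forall p, K q p -> be <= dot gam p.1 -> p.2 <= M0 + cut D pi b p.1.

Lemma limit_cuts_exist : exists2 eta : R, 0 < eta & limit_cuts eta.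
Proof.
have [eta eta0 H] := split_limit_integer; exists eta => // D pi b gam be [s0 s] pos zero.
have [|z Lz|q hq] := H _ _ gam be s0 s.
- by move=> z /pos; rewrite cutE.
- by rewrite -cutE; apply: zero.
by exists q => p; rewrite cutE; apply: hq.
Qed.

Lemma split_cut q D pi b (al : 'rV[int]_m) (be : int) :
  (forall p, K q p -> dotZ al p.1 <= be%:~R -> p.2 <= M0 + cut D pi b p.1) ->
  (forall p, K q p -> (be + 1)%:~R <= dotZ al p.1 -> p.2 <= M0 + cut D pi b p.1) ->
  forall p, K q.+1 p -> p.2 <= M0 + cut D pi b p.1.
Proof.
move=> h1 h2 p Kp; rewrite cutE addrA.
by apply: (@split_closure_cut _ _ (K q) _ _ al be) => // r Kr hr; rewrite -addrA -cutE;
  [apply: h1|apply: h2].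
Qed.

(* If the integer zeros of the cut lie on a proper face [al x <= be] of [L], the
   multiple [(be - al x) / N] of the face inequality is obtained first, then the
   difference with it by one more split. *)
Lemma face_cut eta D pi b (a : vec R m) (be : R) i0 z0 :
  0 < eta -> limit_cuts eta -> (0 < D)%N -> small_cut eta D pi b ->
  (forall z, L (intv R z) -> 0 <= cut D pi b (intv R z)) ->
  (forall i, dot a (pt i) <= be) -> dot a (pt i0) < be ->
  (forall z, L (intv R z) -> cut D pi b (intv R z) = 0 -> dot a (intv R z) = be) ->
  L (intv R z0) -> cut D pi b (intv R z0) = 0 ->
  exists q, forall p, K q p -> p.2 <= M0 + cut D pi b p.1.
Proof.
move=> eta0 lim D0 sm pos ab ab0 zero Lz0 z00.
have [al [be' [alb altight al0]]] := rational_face pt_rat ab ab0.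
have alL y : L y -> dotZ al y <= be'%:~R.
  by rewrite dotZE; apply: polytope_le => i; rewrite -dotZE.
have al_tight z : L (intv R z) -> cut D pi b (intv R z) = 0 -> dotZ al (intv R z) = be'%:~R.
  move=> Lz zz; rewrite dotZE; apply: (polytope_tight ab _ Lz (zero z Lz zz)) => i.
  by rewrite -dotZE; apply: altight.
have aln0 : intv R al != 0.
  apply/eqP => al00; have e := al_tight _ Lz0 z00; move: al0; rewrite -e !dotZE al00.
  by rewrite /dot !big1 ?ltxx // => i _; rewrite mxE mul0r.
have [kap kap0 hkap] : exists2 kap : R, 0 < kap & forall p, Q p ->
    be'%:~R <= dot (intv R al) p.1 -> p.2 <= M0 - kap * (dot (intv R al) p.1 - be'%:~R).
  by apply: height_valid => // y; rewrite -dotZE; apply: alL.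
have [N1 h1] := small_cut_large al be' eta0.
have [|N2 h2] := @eventually_positive R _ [:: tt] (fun=> kap) (fun=> -1); first by [].
pose n := maxn N1 N2; pose N := n.+1.
have smN : small_cut eta N al be' by apply: h1; apply: leq_maxl.
have kapN : N%:R^-1 <= kap.
  by have := h2 n (leq_maxr _ _) tt (mem_head _ _); rewrite mulN1r subr_gt0 => /ltW.
(* The half-space is [al x <= be' - 1], while the zeros of this cut lie on [al x = be']. *)
have [||q1 hq1] := lim N al be' (- intv R al) (1 - be'%:~R) smN.
- by move=> z /alL; rewrite cut_ge0.
- move=> z Lz /eqP; rewrite cut_eq0 // => /eqP e.
  by rewrite dotC -scaleN1r dotZr dotC -dotZE e; lra.
have face p : K q1.+1 p -> p.2 <= M0 + cut N al be' p.1.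
  apply: (@split_cut q1 N al be' al (be' - 1)) => r Kr.
    rewrite intrB => hr; apply: hq1 => //.
    by rewrite dotC -scaleN1r dotZr dotC -dotZE; lra.
  (* Beyond the face, z drops at rate [kap], which is at least the rate [1 / N] of the cut. *)
  rewrite subrK => hr; have Qr : Q r by apply: (K_decr (leq0n q1)).
  have := hkap r Qr; rewrite -dotZE => /(_ hr) /le_trans; apply.
  have d0 : 0 <= dotZ al r.1 - be'%:~R by rewrite subr_ge0.
  by have := ler_wpM2r d0 kapN; rewrite /cut; move: (N%:R^-1) => t; lra.
(* Numerator of the original cut minus the face cut. Where the difference is nonnegative, the face
   cut suffices; it vanishes at every integer zero, so the limit argument covers the side
   [b2 + 1]. *)
pose pi2 := cut_add D N pi (- al); pose b2 := N%:Z * b + D%:Z * (- be').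
have DN0 : (0 < D * N)%N by rewrite muln_gt0 D0.
have cut2 x : cut (D * N) pi2 b2 x = cut D pi b x - cut N al be' x.
  by rewrite cutD // cutN.
have [|q2 hq2] := lim D pi b (intv R pi2) (b2 + 1)%:~R sm pos.
  move=> z Lz zz; have e := al_tight z Lz zz.
  have /eqP : cut (D * N) pi2 b2 (intv R z) = 0.
    by rewrite cut2 zz /cut e subrr mul0r subrr.
  by rewrite cut_eq0 // dotZE => /eqP ->; rewrite ltr_int ltrDl.
exists (maxn q1.+1 q2).+1; apply: (@split_cut _ D pi b pi2 b2) => r Kr hr.
  have := face r (K_decr (leq_maxl _ _) Kr) => /le_trans; apply.
  by move: hr; rewrite lerD2l -(cut_ge0 _ _ _ DN0) cut2 subr_ge0.
by apply: hq2; [exact: (K_decr (leq_maxr _ _) Kr)|rewrite -dotZE].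
Qed.

Lemma integer_hull_sub x : integer_hull L x -> L x.
Proof.
rewrite /integer_hull convE; apply: convex_set_hull => [|y []//].
by rewrite /L convE; apply: hull_convex.
Qed.

Lemma integral_points_finite : exists V : seq 'rV[int]_m, forall z, z \in V <-> L (intv R z).
Proof.
have [B _ hB] := polytope_norm1_bounded pt.
have [V hV] := int_box_finite m (Num.truncn B).
exists [seq z <- V | `[< L (intv R z) >]] => z; rewrite mem_filter; split.
  by move=> /andP[/asboolP].
move=> Lz; rewrite (asboolT Lz) hV // => i.
have : `|z 0 i|%:~R < (Num.truncn B).+1%:Z%:~R :> R.
  apply: le_lt_trans (truncnS_gt B); apply: le_trans (hB _ Lz).
  by apply: le_trans (norm1_coord _ i); rewrite mxE intr_norm.
by rewrite ltr_int intS addrC ltzD1.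
Qed.

Lemma proper_face_vertex (a : vec R m) (b : R) x :
  (forall y, L y -> dot a y <= b) -> L x -> dot a x != b -> exists i, dot a (pt i) < b.
Proof.
move=> ab Lx xb; apply: contrapT => /forallNP h.
have e i : dot a (pt i) = b.
  apply/eqP; rewrite eq_le ab /=; last exact: polytope_vertex.
  by rewrite leNgt; apply/negP/h.
have d0 y : dot (0 : vec R m) y = 0 by rewrite /dot big1 // => j _; rewrite mxE mul0r.
move/eqP: xb; apply; apply: (@polytope_tight _ _ _ pt 0 a 0) => // i.
by rewrite d0.
Qed.

Lemma cut_split_rank eta D pi b :
  0 < eta -> limit_cuts eta -> (0 < D)%N -> small_cut eta D pi b ->
  (forall z, L (intv R z) -> 0 <= cut D pi b (intv R z)) ->
  exists q, forall p, K q p -> p.2 <= M0 + cut D pi b p.1.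
Proof.
move=> eta0 lim.
have [V hV] := integral_points_finite.
have [n] := ubnP (count (fun z => cut D pi b (intv R z) == 0) V).
elim: n D pi b => // n IH D pi b cnt D0 sm pos.
have [[z0 [Lz0 zz0]]|nz] :=
  pselect (exists z, L (intv R z) /\ cut D pi b (intv R z) = 0); last first.
  (* Without zeros the trivial half-space [0 <= 0], that is the whole space, is allowed. *)
  have [|q hq] := lim D pi b 0 0 sm pos.
    by move=> z Lz zz; case: nz; exists z.
  exists q => p Kp; apply: hq => //.
  by rewrite /dot big1 // => i _; rewrite mxE mul0r.
have [[a [be [ab [x [Lx xb]] zero]]]|nface] := pselect (exists (a : vec R m) (be : R),
    [/\ forall y, L y -> dot a y <= be, exists x, L x /\ dot a x != be &
      forall z, L (intv R z) -> cut D pi b (intv R z) = 0 -> dot a (intv R z) = be]).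
  have [i0 ab0] := proper_face_vertex ab Lx xb.
  apply: (face_cut eta0 lim D0 sm pos _ ab0 zero Lz0 zz0) => i.
  by apply: ab; apply: polytope_vertex.
(* A face of the integer hull whose integer points are exactly the zeros of the cut. *)
pose F : set (vec R m) := fun x => integer_hull L x /\ dot (intv R pi) x = b%:~R.
have Fz z : (F (intv R z) /\ is_int_vec (intv R z)) <->
    (L (intv R z) /\ cut D pi b (intv R z) = 0).
  split=> [[[/integer_hull_sub Lz e] _]|[Lz /eqP]].
    by split=> //; apply/eqP; rewrite cut_eq0 // dotZE e.
  rewrite cut_eq0 // dotZE => /eqP e; split; last by exists z.
  split=> //; rewrite /integer_hull convE.
  exists 1%N, (fun=> intv R z), (fun=> 1); rewrite !big_ord1 scale1r; split=> // _.
  by split=> //; exists z.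
have faceF : face (integer_hull L) F.
  exists (intv R pi), b%:~R; split=> // x; rewrite /integer_hull convE.
  pose W : set (vec R m) := [set x | dot (intv R pi) x <= b%:~R].
  apply: (@convex_set_hull _ _ W) => [u v t /andP[t0 t1] hu hv|y [Ly [z yz]]].
    rewrite /W /= in hu hv *; rewrite dotD !dotZr.
    by rewrite -subr_ge0 in t1; have := ler_wpM2l t0 hv; have := ler_wpM2l t1 hu; lra.
  by rewrite yz in Ly *; have := pos z Ly; rewrite cut_ge0 // dotZE.
have nfacet : ~ exists G, facet L G /\ F `<=` G.
  move=> [G [[[a [be [ab GE]]] [GL _]] FG]]; apply: nface; exists a, be; split=> //.
    apply: contrapT => h; apply: GL; rewrite GE; apply/funext => x; apply/propext.
    split=> [[]//|Lx]; split=> //; apply/eqP; apply: contrapT => /negP xb.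
    by apply: h; exists x.
  move=> z Lz zz; have [Fz' _] := (Fz z).2 (conj Lz zz).
  by have := FG _ Fz'; rewrite GE => -[].
have [one|[al [be [S1 [S2 [[x1 S1x] [[x2 S2x] [S12 [SE [h1 h2]]]]]]]]]] := L_2hp faceF nfacet.
  (* A single zero is integral, hence not interior, and a supporting hyperplane there gives a proper
     face. *)
  case: nface.
  have nint : ~ interior_pts L (intv R z0) by move=> /L_free; apply; exists z0.
  have [a an0 apt] := polytope_support Lz0 nint.
  have ab y : L y -> dot a y <= dot a (intv R z0) by apply: polytope_le.
  exists a, (dot a (intv R z0)); split=> //.
    have [x xint] := L_full; exists x; split; first exact: interior_sub.
    by rewrite lt_eqF //; apply: interior_lt xint.
  move=> z Lz zz; congr (dot a _).
  by apply: one; apply/Fz.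
have part z : L (intv R z) -> cut D pi b (intv R z) = 0 ->
    dotZ al (intv R z) = be%:~R \/ dotZ al (intv R z) = (be + 1)%:~R.
  move=> Lz zz; have : (S1 `|` S2) (intv R z) by rewrite -SE; apply/Fz.
  by move=> [/h1|/h2]; [left|right].
have get x : (S1 `|` S2) x ->
    exists z, [/\ x = intv R z, L (intv R z) & cut D pi b (intv R z) = 0].
  rewrite -SE => -[Fx [z xz]]; exists z.
  have e : x = intv R z by [].
  rewrite e in Fx *; have [|Lz zz] := (Fz z).1; last by split.
  by split=> //; exists z.
(* The added cut is nonnegative at all zeros and positive at one, so the count drops; a large [N]
   keeps the other integer points positive and the sum small. *)
have step (al' : 'rV[int]_m) (be' : int) :
    (forall z, L (intv R z) -> cut D pi b (intv R z) = 0 -> dotZ al' (intv R z) <= be'%:~R) ->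
    (exists z, [/\ L (intv R z), cut D pi b (intv R z) = 0 & dotZ al' (intv R z) < be'%:~R]) ->
    exists N0, forall N, (N0 <= N)%N ->
      exists q, forall p, K q p -> p.2 <= M0 + (cut D pi b p.1 + cut N.+1 al' be' p.1).
  move=> le [y [Ly yy lty]].
  have [N1 hN1] := small_cutD al' be' D0 sm.
  pose V' := [seq z <- V | 0 < cut D pi b (intv R z)].
  have [|N2 hN2] := @eventually_positive R _ V' (fun z => cut D pi b (intv R z))
      (fun z => be'%:~R - dotZ al' (intv R z)).
    by move=> z; rewrite mem_filter => /andP[].
  exists (maxn N1 N2) => N; rewrite geq_max => /andP[/hN1 smN /hN2 {}hN2].
  pose pi2 := cut_add D N.+1 pi al'; pose b2 := N.+1%:Z * b + D%:Z * be'.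
  have E x : cut (D * N.+1) pi2 b2 x = cut D pi b x + cut N.+1 al' be' x by apply: cutD.
  have pos2 z : L (intv R z) -> cut D pi b (intv R z) != 0 ->
      0 < cut (D * N.+1) pi2 b2 (intv R z).
    move=> Lz zz; rewrite E; apply: hN2; rewrite mem_filter lt_def zz pos //=.
    exact/hV.
  have [|||q hq] := IH (D * N.+1)%N pi2 b2 _ _ smN.
  - apply: leq_trans _ (ltnSE cnt); apply: (@count_lt _ _ _ _ y).
    + move=> z /hV Lz; apply: contraLR => zz.
      by rewrite gt_eqF // pos2.
    + exact/hV.
    + by rewrite yy.
    + by rewrite E yy add0r gt_eqF // divr_gt0 ?ltr0n // subr_gt0.
  - by rewrite muln_gt0 D0.
  - move=> z Lz; have [zz|/(pos2 z Lz)/ltW//] := eqVneq (cut D pi b (intv R z)) 0.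
    by rewrite E zz add0r cut_ge0 // le.
  by exists q => p; rewrite -E; apply: hq.
have [z1 [e1 Lz1 zz1]] := get x1 (or_introl S1x).
have [z2 [e2 Lz2 zz2]] := get x2 (or_intror S2x).
have B1 : (be + 1)%:~R = be%:~R + 1 :> R by rewrite intrD.
have [||N1 hN1] := step (- al) (- be).
- by move=> z Lz zz; rewrite dotZN intrN lerN2; have [->|->] := part z Lz zz; rewrite ?B1; lra.
- by exists z2; split=> //; rewrite dotZN intrN ltrN2 -e2 h2 // B1; lra.
have [||N2 hN2] := step al (be + 1).
- by move=> z Lz zz; have [->|->] := part z Lz zz; rewrite ?B1; lra.
- by exists z1; split=> //; rewrite -e1 h1 // B1; lra.
pose N := maxn N1 N2.
have [q1 hq1] := hN1 N (leq_maxl _ _).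
have [q2 hq2] := hN2 N (leq_maxr _ _).
(* On each side of the split the corresponding added term is nonpositive, so the stronger inequality
   implies the desired one. *)
exists (maxn q1 q2).+1; apply: (@split_cut _ D pi b al be) => r Kr hr.
  apply: le_trans (hq1 r (K_decr (leq_maxl _ _) Kr)) _.
  by rewrite lerD2l gerDl cutN oppr_le0 cut_ge0.
apply: le_trans (hq2 r (K_decr (leq_maxr _ _) Kr)) _.
rewrite lerD2l gerDl -oppr_ge0 -cutN cut_ge0 //.
by rewrite dotZN intrN lerN2.
Qed.

End Relaxation.

(** * The zero cut and the bound on the height *)

Theorem theorem5 (R : realType) (m : nat) (L : set (vec R m)) (M M0 : R) :
  rational_polytope L -> full_dimensional L -> lattice_free L ->
  two_hyperplane_property L ->
  M0 < M ->
  forall Q : set (vec R m * R), polyhedron2 Q -> Q `<=` Rset L M M0 ->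
  exists q : nat, (height (rank_split_closure q Q) <= M0%:E)%E.
Proof.
move=> [k [pt [pt_rat LE]]] L_full L_free L_2hp ltM Q polyQ QR.
rewrite LE in L_full L_free L_2hp QR.
(* In dimension 0 the only point would be both integral and interior. *)
have m0 : (0 < m)%N.
  rewrite lt0n; apply/eqP => m0; have [x xint] := L_full.
  apply: (L_free x xint); exists 0; apply/rowP => i.
  by move: (ltn_ord i); rewrite [X in (_ < X)%N]m0.
have cQ := polyhedron2_convex polyQ.
have clQ := polyhedron2_closed polyQ.
have [eta eta0 lim] := limit_cuts_exist m0 L_full L_free ltM QR cQ clQ.
have [|||q hq] := cut_split_rank m0 L_full L_free ltM QR cQ pt_rat L_2hp eta0 lim
  (D := 1) (pi := 0) (b := 0).
- by [].
- by split=> [|i]; rewrite ?mul0r ?normr0 // !mxE mulr0 normr0.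
- move=> z _; rewrite cut_ge0 // /dotZ big1 // => i _.
  by rewrite mxE mul0r.
exists q; apply: ge_ereal_sup => _ [x _ <-]; apply: ge_ereal_sup => _ [z Kz <-].
rewrite lee_fin; have := hq _ Kz; rewrite /cut /dotZ big1 ?subrr ?mul0r ?addr0 // => i _.
by rewrite mxE mul0r.
Qed.
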